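(* Let $\eta=(\eta_1,\dots,\eta_n)$ be a composition and $a<b$ nonnegative integers such that every part of $\eta$ equal to $a$ lies to the left of every part equal to $b$ (i.e. the parts of sizes $a$ and $b$ occur in increasing order from left to right), and such that $\eta$ has no part $h$ with $a<h<b$. Let $\hat\eta$ be the composition obtained from $\eta$ either by changing all parts equal to $a$ into $b$, or by changing all parts equal to $b$ into $a$. Then at $q=1$, \[ \frac{E_\eta(\mathbf{x};1,t)}{E_{\hat\eta}(\mathbf{x};1,t)}=\left(\frac{e_{\#\{i:\eta_i\ge b\}}(\mathbf{x})}{e_{\#\{i:\hat\eta_i\ge b\}}(\mathbf{x})}\right)^{b-a}. \]
   Context: $\mathbf{x}=(x_1,\dots,x_n)$ and $e_k(\mathbf{x})$ is the elementary symmetric polynomial of degree $k$ ($e_0=1$). Nonsymmetric Macdonald polynomials: for $f\in\mathbb{Q}(q,t)[x_1,\dots,x_n]$ and $1\le i\le n-1$, $s_if$ swaps $x_i,x_{i+1}$; $L_if=\frac{tx_i-x_{i+1}}{x_i-x_{i+1}}(f-s_if)$; $T_if=tf-L_if$; $T_i^{-1}f=t^{-1}f-t^{-1}L_if$; $(\omega f)(x_1,\dots,x_n)=f(qx_n,x_1,\dots,x_{n-1})$; $Y_i=t^{-(i-1)}T_i^{-1}\cdots T_{n-1}^{-1}\,\omega\, T_1\cdots T_{i-1}$. For a composition $\eta$ (an $n$-tuple of nonnegative integers) let $y_i(\eta)=q^{\eta_i}t^{-\#\{j>i:\eta_j\ge\eta_i\}-\#\{j<i:\eta_j>\eta_i\}}$.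 Let $\eta^+$ be the weakly decreasing rearrangement of $\eta$. For partitions of equal size, $\lambda\le\mu$ means $\lambda_1+\dots+\lambda_i\le\mu_1+\dots+\mu_i$ for all $i$; for compositions, $\eta\le\nu$ means either $\eta^+\le\nu^+$, or $\eta^+=\nu^+$ and $\eta_1+\dots+\eta_i\le\nu_1+\dots+\nu_i$ for all $i$. The nonsymmetric Macdonald polynomial $E_\eta(\mathbf{x};q,t)$ is the unique polynomial of the form $\sum_{\zeta\le\eta}v_{\eta,\zeta}(q,t)\mathbf{x}^\zeta$ with $v_{\eta,\eta}=1$ such that $Y_iE_\eta=y_i(\eta)E_\eta$ for all $1\le i\le n$. $E_\eta(\mathbf{x};1,t)$ is its specialisation at $q=1$. *)

(* Defs.v *)
From HB Require Import structures.
From mathcomp Require Import all_boot all_order all_algebra all_fingroup.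
From mathcomp.multinomials Require Export mpoly.

Set Implicit Arguments.
Unset Strict Implicit.
Unset Printing Implicit Defensive.

Import GRing.Theory.
Local Open Scope ring_scope.

(* The field Q(q,t) is built as Q(t)(q), so that setting q = 1 is evaluation
   of univariate polynomials over Q(t). *)
Notation Qt := {fraction {poly rat}}.
Notation Qqt := {fraction {poly Qt}}.

Notation "x %:F" := (@tofrac _ x) : ring_scope.

Definition qvar : Qqt := ('X : {poly Qt})%:F.
Definition tvar : Qqt := ((('X : {poly rat})%:F)%:P : {poly Qt})%:F.

Section Operators.

Context (n : nat) (R : idomainType).
Implicit Types (f g : {mpoly R[n]}) (i : 'I_n.-1).

(* Positions are numbered from 0: i : 'I_n.-1 stands for the index i + 1 of
   s_(i+1), and ordl i, ordr i are the positions of x_(i+1) and x_(i+2). *)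
Definition ordl i : 'I_n := widen_ord (leq_pred n) i.

Fact ordr_subproof i : (i.+1 < n)%N.
Proof. by rewrite -ltn_predRL. Qed.

Definition ordr i : 'I_n := Ordinal (ordr_subproof i).

Definition swap i f : {mpoly R[n]} := msym (tperm (ordl i) (ordr i)) f.

Fact divdiff_subproof i f :
  exists g, ('X_(ordl i) - 'X_(ordr i)) * g == f - swap i f.
Proof.
rewrite /swap; set s := tperm _ _; set d := 'X_(ordl i) - _.
have mulP f1 f2 : (exists g, d * g == f1 - msym s f1) ->
    (exists g, d * g == f2 - msym s f2) ->
    exists g, d * g == f1 * f2 - msym s (f1 * f2).
  move=> [g1 /eqP e1] [g2 /eqP e2]; exists (f1 * g2 + g1 * msym s f2).
  rewrite mulrDr mulrCA e2 mulrA e1 msymM mulrBr mulrBl.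
  by rewrite addrA subrK.
have oneP : exists g, d * g == 1 - msym s 1.
  by exists 0; rewrite mulr0 msym1 subrr.
have varP k : exists g, d * g == 'X_k - msym s 'X_k.
  have -> : msym s 'X_k = 'X_(s k) :> {mpoly R[n]}.
    rewrite msymX; congr 'X_[_]; apply/mnmP => j.
    rewrite !mnmE; congr nat_of_bool.
    by apply/eqP/eqP => [->|<-]; rewrite ?permKV ?permK.
  rewrite /s; case: tpermP => [->|->|_ _].
  - by exists 1; rewrite mulr1.
  - by exists (-1); rewrite mulrN1 opprB.
  - by exists 0; rewrite mulr0 subrr.
elim/mpolyind: f => [|c m f _ _ [g /eqP eg]].
  by exists 0; rewrite mulr0 msym0 subrr.
have [h /eqP eh] : exists h, d * h == 'X_[m] - msym s 'X_[m].
  rewrite mpolyXE_id; elim/big_rec: _ => //= k p _ hp.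
  apply: (mulP _ _ _ hp); elim: (m k) => [|e IHe] //; rewrite exprS.
  exact: (mulP _ _ (varP k)).
exists (c *: h + g).
by rewrite mulrDr -scalerAr eg eh msymD msymZ scalerBr opprD addrACA.
Qed.

(* The polynomial (f - s_i f) / (x_i - x_(i+1)). *)
Definition divdiff i f : {mpoly R[n]} := xchoose (divdiff_subproof i f).

End Operators.

Section NonsymMacdonald.

Context (n : nat).
Implicit Types (f : {mpoly Qqt[n]}) (eta nu zeta : 'X_{1..n}).

Definition Lop (i : 'I_n.-1) f : {mpoly Qqt[n]} :=
  (tvar *: 'X_(ordl i) - 'X_(ordr i)) * divdiff i f.

Definition Top (i : 'I_n.-1) f : {mpoly Qqt[n]} := tvar *: f - Lop i f.

Definition Tinv (i : 'I_n.-1) f : {mpoly Qqt[n]} :=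
  tvar^-1 *: f - tvar^-1 *: Lop i f.

(* ord_pred is the cyclic predecessor: x_1 is replaced by q x_n and x_(i+1)
   by x_i. *)
Definition omega f : {mpoly Qqt[n]} :=
  f \mPo [tuple (if i == 0 :> nat then qvar else 1) *: 'X_(ord_pred i) | i < n].

(* For i : 'I_n the indices j + 1 with j < i run over 1, ..., i and those with
   i <= j over i + 1, ..., n - 1; foldr puts the smallest index outermost. *)
Definition Yop (i : 'I_n) f : {mpoly Qqt[n]} :=
  tvar ^- i *:
    foldr Tinv
      (omega (foldr Top f [seq j : 'I_n.-1 <- enum 'I_n.-1 | (j < i)%N]))
      [seq j : 'I_n.-1 <- enum 'I_n.-1 | (i <= j)%N].

Definition yval (eta : 'X_{1..n}) (i : 'I_n) : Qqt :=
  qvar ^+ eta i *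
  tvar ^- (#|[set j : 'I_n | (i < j)%N && (eta i <= eta j)%N]| +
           #|[set j : 'I_n | (j < i)%N && (eta i < eta j)%N]|).

Definition parts (eta : 'X_{1..n}) : seq nat := [seq eta i | i <- enum 'I_n].

Definition decr (eta : 'X_{1..n}) : seq nat := sort geq (parts eta).

Definition psum_le (s u : seq nat) : Prop :=
  forall k : nat, (sumn (take k s) <= sumn (take k u))%N.

Definition partition_le (s u : seq nat) : Prop :=
  sumn s = sumn u /\ psum_le s u.

(* The first alternative is the weak dominance order, so it already allows all
   rearrangements of nu. Making it strict would leave E_(0,1) undefined: for
   n = 2 the eigenvector is x_2 + c x_1 with c != 0, whereas (1,0) is not below
   (0,1) for the partial-sum order. *)
Definition composition_le (eta nu : 'X_{1..n}) : Prop :=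
  partition_le (decr eta) (decr nu) \/
  (decr eta = decr nu /\ psum_le (parts eta) (parts nu)).

Definition is_nonsym_macdonald (eta : 'X_{1..n}) (E : {mpoly Qqt[n]}) : Prop :=
  [/\ forall zeta, zeta \in msupp E -> composition_le zeta eta,
      E@_eta = 1
    & forall i : 'I_n, Yop i E = yval eta i *: E].

Definition change_part (c d : nat) (eta : 'X_{1..n}) : 'X_{1..n} :=
  [multinom (if eta i == c then d else eta i) | i < n].

Definition num_ge (b : nat) (eta : 'X_{1..n}) : nat :=
  #|[set i : 'I_n | (b <= eta i)%N]|.

End NonsymMacdonald.

(* r is regular at q = 1, with value v; the value does not depend on the
   fraction p / d chosen. *)
Definition value_at_q1 (r : Qqt) (v : Qt) : Prop :=
  exists p d : {poly Qt}, [/\ d.[1] != 0, r = p%:F / d%:F & v = p.[1] / d.[1]].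

Definition specializes_q1 (n : nat) (E : {mpoly Qqt[n]})
    (E1 : {mpoly Qt[n]}) : Prop :=
  forall m : 'X_{1..n}, value_at_q1 E@_m E1@_m.

(* Main.v *)
From HB Require Import structures.
Require Import Defs.
From mathcomp Require Import all_boot all_order all_algebra all_fingroup.
From mathcomp.multinomials Require Import mpoly.
From mathcomp Require Import zify ring.

Set Implicit Arguments.
Unset Strict Implicit.
Unset Printing Implicit Defensive.

Import GRing.Theory.
Local Open Scope ring_scope.

(**
  At q = 1 the operators Y_i commute with multiplication by symmetric
  polynomials.  Let Y'_i be the derivative of Y_i in q at q = 1.  The operators
  Y_i and Y'_1 + ... + Y'_n are triangular on monomials, for the order comparing
  first the sum of the squares of the exponents and then the sum of the
  i eta_i; their diagonal entries t^(-k_i) and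
  eta_1 t^(-k_1) + ... + eta_n t^(-k_n) determine eta.  Hence E_eta is regular
  at q = 1, and its value there is the only joint eigenvector with these
  eigenvalues and coefficient 1 at x^eta.

  For symmetric s, the commutator of Y'_1 + ... + Y'_n with s commutes with all
  T_i and with x_1, hence with all x_i, so it is itself the multiplication by a
  polynomial; for s = e_k this polynomial is (1 + t^(-1) + ... + t^(1-k)) e_k.
  Therefore e_k E_eta is at q = 1 the eigenvector of eta + 1_S, S being the set
  of the k largest parts of eta, where among equal parts the rightmost is the
  largest.  With k and k' the numbers of parts at least b of eta and etahat,
  both e_k'^(b-a) E_eta and e_k^(b-a) E_etahat are then the eigenvector of the
  same composition.
*)

(** * Demazure-Lusztig operators *)

(** At $q=1$ the eigenvalues of the $Y_i$ record only the ranks $k_i$ of the parts, so they cannot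
    separate compositions whose parts are ordered in the same way; information of first order in
    $q-1$ is needed. Differentiating $Y_iE=y_iE$ brings in the unknown derivative of $E$. After
    summation over $i$ this derivative meets only $\sum_i Y_i$, which at $q=1$ is a scalar, so it
    cancels; this is why the sum of the $Y'_i$ is used.

    Both this scalar and the commutator with a symmetric $s$ are instances of one construction:
    $Y_i$ with the multiplication by some $g$ inserted after the cyclic shift, where $g=1$ or
    $g=x_n\,\partial s/\partial x_n$. Such a $g$ is symmetric in $x_1,\dots,x_{n-1}$.

    The sum of squares is invariant under rearrangement and drops when two exponents move closer
    together. It bounds the support of $(\sum_i Y'_i)e_k$ by squarefree monomials, and it shows that
    $x^{\eta+1_S}$ arises in $e_kE_\eta$ in only one way. The constant attached to $e_k$ is the sum
    of $t^{-j}$ over the ranks $j=0,\dots,k-1$ of the $k$ largest parts. *)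

Section RationalIdentities.

Context (F : fieldType).
Implicit Types (a b c x y : F).

(** The action of $T_k$ over the field of fractions: [x] and [y] stand for $f$ and $s_kf$, [a] and
    [b] for the two variables. With the permuted images of $f$ as free unknowns, each Hecke relation
    becomes an identity of rational functions. *)
Definition heckeF c a b x y := c * x - (c * a - b) / (a - b) * (x - y).

Lemma quotient_form a b c v x y : a - b != 0 ->
  (a - b) * v = c * ((a - b) * x) - (c * a - b) * (x - y) ->
  v = heckeF c a b x y.
Proof. by move=> nz e; apply: (mulfI nz); rewrite e /heckeF; field. Qed.

Lemma heckeF_quad a b c x y : a - b != 0 ->
  heckeF c a b (heckeF c a b x y) (heckeF c b a y x) =
  (c - 1) * heckeF c a b x y + c * x.
Proof.
move=> nz; have nz' : b - a != 0 by rewrite -opprB oppr_eq0.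
by rewrite /heckeF; field; rewrite nz nz'.
Qed.

Lemma heckeF_far a b a' b' c x y x' y' : a - b != 0 -> a' - b' != 0 ->
  heckeF c a b (heckeF c a' b' x x') (heckeF c a' b' y y') =
  heckeF c a' b' (heckeF c a b x y) (heckeF c a b x' y').
Proof. by move=> nz nz'; rewrite /heckeF; field; rewrite nz nz'. Qed.

(** The six unknowns are the images of one polynomial under the permutations of three adjacent
    variables. *)
Lemma heckeF_braid p q r c f1 f2 f12 f21 f3 f0 :
  p - q != 0 -> q - r != 0 -> p - r != 0 ->
  heckeF c p q
    (heckeF c q r (heckeF c p q f0 f1) (heckeF c p r f2 f12))
    (heckeF c p r (heckeF c q p f1 f0) (heckeF c q r f21 f3)) =
  heckeF c q r
    (heckeF c p q (heckeF c q r f0 f2) (heckeF c p r f1 f21))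
    (heckeF c p r (heckeF c r q f2 f0) (heckeF c p q f12 f3)).
Proof.
move=> nz1 nz2 nz3; have nz1' : q - p != 0 by rewrite -opprB oppr_eq0.
have nz2' : r - q != 0 by rewrite -opprB oppr_eq0.
by rewrite /heckeF; field; rewrite nz1 nz2 nz3 nz1' nz2'.
Qed.

End RationalIdentities.

Section Permutations.

Context (n : nat) (R : idomainType).
Implicit Types (f g : {mpoly R[n]}) (s : 'S_n).

Lemma msymXU s (k : 'I_n) : msym s 'X_k = 'X_(s k) :> {mpoly R[n]}.
Proof.
rewrite msymX; congr 'X_[_]; apply/mnmP => j; rewrite !mnmE; congr nat_of_bool.
by apply/eqP/eqP => [->|<-]; rewrite ?permKV ?permK.
Qed.

Lemma mpolyXU_eq (i j : 'I_n) : ('X_i == 'X_j :> {mpoly R[n]}) = (i == j).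
Proof.
apply/eqP/eqP => [/(congr1 (mcoeff U_(i)))|->] //.
by rewrite !mcoeffXU eqxx; case: eqVneq => // _ /eqP; rewrite oner_eq0.
Qed.

Lemma divdiffE (i : 'I_n.-1) f :
  ('X_(ordl i) - 'X_(ordr i)) * divdiff i f = f - swap i f.
Proof. exact/eqP/(xchooseP (divdiff_subproof i f)). Qed.

End Permutations.

Section Operators.

Context (N : nat) (R : idomainType) (t u : R).
Local Notation P := {mpoly R[N.+1]}.
Implicit Types (f g : P) (k : nat).

Definition pos k : 'I_N.+1 := inord k.
Definition varX k : P := 'X_(pos k).
Definition tr k : 'S_N.+1 := tperm (pos k) (pos k.+1).
Definition sw k f : P := msym (tr k) f.

(* Outside the range k < N the operator is the identity, a junk value. *)
Definition heckeT k f : P :=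
  if insub k is Some j
  then t *: f - (t *: 'X_(ordl j) - 'X_(ordr j)) * divdiff (n := N.+1) j f
  else f.

(** The relation $(T_k-t)(T_k+1)=0$ gives $T_k^{-1}=t^{-1}T_k-(1-t^{-1})$. The inverse of $t$ is a
    separate parameter [u], so that the operators also live over polynomial rings. *)
Definition heckeTi k f : P := u *: heckeT k f - (1 - u) *: f.

Lemma posK k : (k <= N)%N -> pos k = k :> nat.
Proof. exact: inordK. Qed.

Lemma pos_eq j k : (j <= N)%N -> (k <= N)%N -> (pos j == pos k) = (j == k).
Proof. by move=> hj hk; rewrite -val_eqE /= !posK. Qed.

Lemma pos_val (i : 'I_N.+1) : pos i = i. Proof. exact: inord_val. Qed.

Lemma xv_neq j k : (j <= N)%N -> (k <= N)%N -> j != k -> varX j - varX k != 0.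
Proof. by move=> hj hk h; rewrite subr_eq0 mpolyXU_eq pos_eq. Qed.

Lemma hTE k f : (k < N)%N ->
  (varX k - varX k.+1) * heckeT k f =
  t *: ((varX k - varX k.+1) * f) - (t *: varX k - varX k.+1) * (f - sw k f).
Proof.
move=> hk; rewrite /heckeT insubT /=; set j := Sub _ _.
have el : ordl (n := N.+1) j = pos k.
  by apply: val_inj; rewrite /= posK // ltnW.
have er : ordr (n := N.+1) j = pos k.+1 by apply: val_inj; rewrite /= posK.
rewrite el er mulrBr scalerAr mulrCA; congr (_ - _ * _).
by have := divdiffE (n := N.+1) j f; rewrite /swap el er.
Qed.

Local Notation toF := (@tofrac P).

Definition permF (s : 'S_N.+1) f := toF (msym s f).
Definition varF (i : 'I_N.+1) := toF 'X_i.

Lemma permF_hT s k f : (k < N)%N ->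
  permF s (heckeT k f) =
  heckeF (toF t%:MP) (varF (s (pos k))) (varF (s (pos k.+1)))
    (permF s f) (permF (tr k * s)%g f).
Proof.
move=> hk; apply: quotient_form.
  rewrite -rmorphB /= tofrac_eq0 subr_eq0 mpolyXU_eq (inj_eq perm_inj).
  by rewrite pos_eq // ?neq_ltn ?ltnSn // ltnW.
have /(congr1 (fun g => toF (msym s g))) := hTE f hk.
rewrite -!mul_mpolyC !(rmorphB, rmorphM) /= !msymXU -!msymMm.
by have -> : msym s t%:MP = t%:MP by rewrite -alg_mpolyC msymZ msym1.
Qed.

Lemma permF1_inj : injective (permF 1).
Proof.
by move=> f g /eqP; rewrite /permF !msym1m tofrac_eq => /eqP.
Qed.

Lemma varF_neq j k : (j <= N)%N -> (k <= N)%N -> j != k ->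
  varF (pos j) - varF (pos k) != 0.
Proof. by move=> *; rewrite -rmorphB /= tofrac_eq0 xv_neq. Qed.

Lemma permF_affine (c d : R) f g :
  permF 1 (c *: f + d *: g) =
  toF c%:MP * permF 1 f + toF d%:MP * permF 1 g.
Proof. by rewrite /permF !msym1m -!mul_mpolyC tofracD !tofracM. Qed.

(** In a domain $x_k-x_{k+1}$ can be cancelled, so values of $T_k$ are checked without opening the
    divided difference. *)
Lemma hT_uniq k f g : (k < N)%N ->
  (varX k - varX k.+1) * g =
  t *: ((varX k - varX k.+1) * f) - (t *: varX k - varX k.+1) * (f - sw k f) ->
  heckeT k f = g.
Proof.
move=> hk e; apply: (mulfI (_ : varX k - varX k.+1 != 0)); last by rewrite hTE.
by rewrite xv_neq // ?neq_ltn ?ltnSn // ltnW.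
Qed.

Lemma hTN k f : (N <= k)%N -> heckeT k f = f.
Proof. by move=> h; rewrite /heckeT insubF // ltnNge h. Qed.

Lemma hT_is_linear k : linear (heckeT k).
Proof.
move=> c f g; case: (ltnP k N) => hk; last by rewrite !hTN.
apply: hT_uniq => //; rewrite mulrDr -scalerAr !hTE // /sw msymD msymZ.
rewrite -!mul_mpolyC; ring.
Qed.

HB.instance Definition _ k :=
  GRing.isLinear.Build R P P _ (heckeT k) (hT_is_linear k).

Lemma hT_sym k g f : (k < N)%N -> sw k g = g -> heckeT k (g * f) = g * heckeT k f.
Proof.
move=> hk e; apply: hT_uniq => //; rewrite mulrCA hTE // /sw msymM -/(sw k g) e.
rewrite -!mul_mpolyC /sw; ring.
Qed.

Lemma hT1 k : (k < N)%N -> heckeT k 1 = t%:MP.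
Proof.
move=> hk; apply: hT_uniq => //; rewrite /sw msym1 -!mul_mpolyC; ring.
Qed.

Lemma hT_invariant k f : (k < N)%N -> sw k f = f -> heckeT k f = t *: f.
Proof.
by move=> hk e; rewrite -[f]mulr1 hT_sym // hT1 // mulr1 mulrC mul_mpolyC.
Qed.

Lemma sw_xvl k : sw k (varX k) = varX k.+1.
Proof. by rewrite /sw msymXU tpermL. Qed.

Lemma sw_xvr k : sw k (varX k.+1) = varX k.
Proof. by rewrite /sw msymXU tpermR. Qed.

Lemma sw_xv k j : (k < N)%N -> (j <= N)%N -> j != k -> j != k.+1 ->
  sw k (varX j) = varX j.
Proof.
by move=> hk hj h1 h2; rewrite /sw msymXU tpermD // pos_eq // 1?eq_sym // ltnW.
Qed.

Lemma hT_xl k f : (k < N)%N ->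
  heckeT k (varX k * f) = varX k.+1 * heckeT k f + (1 - t) *: (varX k.+1 * f).
Proof.
move=> hk; apply: hT_uniq => //; rewrite mulrDr mulrCA hTE // /sw msymM.
rewrite -/(sw k (varX k)) sw_xvl -!mul_mpolyC rmorphB /= /sw; ring.
Qed.

Lemma hT_xr k f : (k < N)%N ->
  heckeT k (varX k.+1 * f) = varX k * heckeT k f - (1 - t) *: (varX k.+1 * f).
Proof.
move=> hk; apply: hT_uniq => //; rewrite mulrBr mulrCA hTE // /sw msymM.
rewrite -/(sw k (varX k.+1)) sw_xvr -!mul_mpolyC rmorphB /= /sw; ring.
Qed.

Local Opaque heckeT permF varF.

Lemma hT_quad k f : (k < N)%N -> heckeT k (heckeT k f) = (t - 1) *: heckeT k f + t *: f.
Proof.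
move=> hk; apply: permF1_inj.
rewrite permF_affine mpolyCB mpolyC1 tofracB tofrac1 !permF_hT // !mulg1 !perm1.
by rewrite /tr tperm2 tpermL tpermR heckeF_quad // varF_neq //; lia.
Qed.

Lemma pos_neq j k : (j <= N)%N -> (k <= N)%N -> j != k -> pos j != pos k.
Proof. by move=> *; rewrite pos_eq. Qed.

Lemma hT_far j k f : (j.+1 < k)%N -> (k < N)%N ->
  heckeT j (heckeT k f) = heckeT k (heckeT j f).
Proof.
move=> hj hk; have hjN : (j < N)%N by lia.
apply: permF1_inj.
rewrite 2!(permF_hT _ _ hjN, permF_hT _ _ hk).
rewrite !(permF_hT _ _ hjN, permF_hT _ _ hk).
rewrite !mulg1 !perm1 /tr.
have [d1 d2 d3 d4] : [/\ pos j != pos k, pos j != pos k.+1,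
    pos j.+1 != pos k & pos j.+1 != pos k.+1] by split; apply: pos_neq; lia.
have [e1 e2 e3 e4] : [/\ pos k != pos j, pos k.+1 != pos j,
  pos k != pos j.+1 & pos k.+1 != pos j.+1] by split; apply: pos_neq; lia.
rewrite (tpermD d1 d3) (tpermD d2 d4) (tpermD e1 e2) (tpermD e3 e4).
have -> : (tperm (pos j) (pos j.+1) * tperm (pos k) (pos k.+1) =
           tperm (pos k) (pos k.+1) * tperm (pos j) (pos j.+1))%g.
  by rewrite conjgC tpermJ !tpermD.
by apply: heckeF_far; rewrite varF_neq //; lia.
Qed.

Lemma hT_braid k f : (k.+1 < N)%N ->
  heckeT k (heckeT k.+1 (heckeT k f)) = heckeT k.+1 (heckeT k (heckeT k.+1 f)).
Proof.
move=> hk; have hkN : (k < N)%N by lia.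
apply: permF1_inj; rewrite !(permF_hT _ _ hkN, permF_hT _ _ hk).
rewrite !mulg1 !perm1 /tr !permM.
have [pq qr pr] : [/\ pos k != pos k.+1, pos k.+1 != pos k.+2 &
  pos k != pos k.+2] by split; apply: pos_neq; lia.
have [qp rq rp] : [/\ pos k.+1 != pos k, pos k.+2 != pos k.+1 &
  pos k.+2 != pos k] by split; apply: pos_neq; lia.
rewrite !mulgA !tperm2.
rewrite !(tpermL, tpermR, tpermD qp rp, tpermD pr qr).
have -> : (tperm (pos k) (pos k.+1) * tperm (pos k.+1) (pos k.+2) *
           tperm (pos k) (pos k.+1) =
           tperm (pos k.+1) (pos k.+2) * tperm (pos k) (pos k.+1) *
           tperm (pos k.+1) (pos k.+2))%g.
  rewrite -[LHS]mulgA -[RHS]mulgA.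
  rewrite -{1}[tperm (pos k) _]tpermV -{2}[tperm (pos k.+1) _]tpermV.
  by rewrite -!conjgE !tpermJ !(tpermL, tpermR) !tpermD.
apply: heckeF_braid; rewrite varF_neq //; lia.
Qed.

End Operators.

Lemma ord_pred_inj n : injective (@ord_pred n).
Proof. exact: can_inj (@ord_predK n). Qed.

Definition cyc n : 'S_n := perm (@ord_pred_inj n).

(** * Products of the operators and the cyclic shift of the variables *)

Section Products.

Context (N : nat) (R : idomainType) (t u : R).
Local Notation P := {mpoly R[N.+1]}.
Local Notation hT := (@heckeT N R t).
Local Notation hTi := (@heckeTi N R t u).
Local Notation xv := (@varX N R).
Implicit Types (f g : P) (k : nat).

Lemma hTi_is_linear k : linear (hTi k).
Proof.
move=> c f g; rewrite /heckeTi linearP !scalerDr !scalerN !scalerA.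
by rewrite ![c * _]mulrC opprD addrACA.
Qed.

HB.instance Definition _ k :=
  GRing.isLinear.Build R P P _ (hTi k) (hTi_is_linear k).

Definition hTs a m f : P := foldr hT f (iota a m).
Definition hTis a m f : P := foldr hTi f (iota a m).
(** This is $\omega$ at $q=1$; the factor $q$ is supplied separately by [qscale]. *)
Definition w1 f : P := msym (cyc N.+1) f.

Lemma hTs_is_linear a m : linear (hTs a m).
Proof.
move=> c f g; rewrite /hTs; elim: (iota a m) => //= k s ->.
by rewrite linearP.
Qed.

HB.instance Definition _ a m :=
  GRing.isLinear.Build R P P _ (hTs a m) (hTs_is_linear a m).

Lemma hTis_is_linear a m : linear (hTis a m).
Proof.
move=> c f g; rewrite /hTis; elim: (iota a m) => //= k s ->.
by rewrite linearP.
Qed.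

HB.instance Definition _ a m :=
  GRing.isLinear.Build R P P _ (hTis a m) (hTis_is_linear a m).

Lemma w1_is_linear : linear w1.
Proof. by move=> c f g; rewrite /w1 msymD msymZ. Qed.

HB.instance Definition _ := GRing.isLinear.Build R P P _ w1 w1_is_linear.

Lemma w1M f g : w1 (f * g) = w1 f * w1 g. Proof. exact: msymM. Qed.

Lemma hTZ k c f : hT k (c *: f) = c *: hT k f.
Proof. by rewrite linearZ. Qed.

Lemma hTsS a m f : hTs a m.+1 f = hT a (hTs a.+1 m f). Proof. by []. Qed.

Lemma hTisS a m f : hTis a m.+1 f = hTi a (hTis a.+1 m f). Proof. by []. Qed.

Lemma hTs_add a m p f : hTs a (m + p) f = hTs a m (hTs (a + m) p f).
Proof. by rewrite /hTs iotaD foldr_cat. Qed.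

Lemma hTis_add a m p f : hTis a (m + p) f = hTis a m (hTis (a + m) p f).
Proof. by rewrite /hTis iotaD foldr_cat. Qed.

Lemma hTsSr a m f : hTs a m.+1 f = hTs a m (hT (a + m) f).
Proof. by rewrite -[m.+1]addn1 hTs_add. Qed.

Lemma hTisSr a m f : hTis a m.+1 f = hTis a m (hTi (a + m) f).
Proof. by rewrite -[m.+1]addn1 hTis_add. Qed.

Lemma hTi_sym k g f : (k < N)%N -> sw k g = g -> hTi k (g * f) = g * hTi k f.
Proof. by move=> hk e; rewrite /heckeTi hT_sym // mulrBr !scalerAr. Qed.

Lemma hTs_sym a m g f : (a + m <= N)%N ->
  (forall k, (a <= k < a + m)%N -> sw k g = g) -> hTs a m (g * f) = g * hTs a m f.
Proof.
elim: m a => [//|m IH] a le_N sym_g; rewrite !hTsS IH ?hT_sym //; first lia.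
- by apply: sym_g; lia.
- lia.
- by move=> k hk; apply: sym_g; lia.
Qed.

Lemma hTis_sym a m g f : (a + m <= N)%N ->
  (forall k, (a <= k < a + m)%N -> sw k g = g) ->
  hTis a m (g * f) = g * hTis a m f.
Proof.
elim: m a => [//|m IH] a le_N sym_g; rewrite !hTisS IH ?hTi_sym //; first lia.
- by apply: sym_g; lia.
- lia.
- by move=> k hk; apply: sym_g; lia.
Qed.

Lemma hTi_hT_far j k f : (j < N)%N -> (k < N)%N ->
  (k.+1 < j)%N || (j.+1 < k)%N -> hTi j (hT k f) = hT k (hTi j f).
Proof.
move=> hj hk far; rewrite /heckeTi linearB !linearZ /=.
by case/orP: far => h; [rewrite -hT_far|rewrite hT_far] => //; lia.
Qed.

Lemma hT_hTis_far k a m f : (k < N)%N -> (a + m <= N)%N ->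
  (k.+1 < a)%N || (a + m < k)%N ->
  hT k (hTis a m f) = hTis a m (hT k f).
Proof.
elim: m a => [//|m IH] a hk ham far; rewrite !hTisS -IH //; try lia.
by rewrite hTi_hT_far //; lia.
Qed.

Lemma hTs_hTis_far a m b p f : (a + m < b)%N -> (b + p <= N)%N ->
  hTs a m (hTis b p f) = hTis b p (hTs a m f).
Proof.
elim: m a => [//|m IH] a h1 h2; rewrite !hTsS IH ?hT_hTis_far //; lia.
Qed.

Lemma cyc_posS k : (k < N)%N -> cyc N.+1 (pos N k.+1) = pos N k.
Proof.
move=> hk; rewrite permE; apply: val_inj; rewrite [LHS]/= -[RHS]/(nat_of_ord _) (posK hk).
by rewrite (posK (ltnW hk)) addSn modnDr modn_small // ltnS ltnW.
Qed.

Lemma cyc_pos0 : cyc N.+1 (pos N 0) = pos N N.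
Proof.
rewrite permE; apply: val_inj; rewrite [LHS]/= -[RHS]/(nat_of_ord _) (posK (leq0n N)).
by rewrite (posK (leqnn N)) modn_small.
Qed.

Lemma w1_xvS k : (k < N)%N -> w1 (xv k.+1) = xv k.
Proof. by move=> hk; rewrite /w1 msymXU cyc_posS. Qed.

Lemma w1_xv0 : w1 (xv 0) = xv N.
Proof. by rewrite /w1 msymXU cyc_pos0. Qed.

Lemma w1_sw k f : (k.+1 < N)%N -> w1 (sw k.+1 f) = sw k (w1 f).
Proof.
move=> hk; rewrite /w1 /sw -!msymMm conjgC tpermJ !cyc_posS //.
exact: ltnW.
Qed.

Lemma w1_hT k f : (k.+1 < N)%N -> w1 (hT k.+1 f) = hT k (w1 f).
Proof.
move=> hk; apply/esym/hT_uniq; first exact: ltnW.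
have /(congr1 w1) := hTE t f hk.
by rewrite linearB linearZ /= !w1M !linearB /= linearZ /= !w1_xvS ?w1_sw // ltnW.
Qed.

Lemma w1_hTs a m f : (a.+1 + m <= N)%N -> w1 (hTs a.+1 m f) = hTs a m (w1 f).
Proof. by elim: m a => [//|m IH] a h; rewrite !hTsS w1_hT ?IH //; lia. Qed.

Context (ut : u * t = 1).

Lemma hTK k : (k < N)%N -> cancel (hT k) (hTi k).
Proof.
move=> hk f; rewrite /heckeTi hT_quad // scalerDr !scalerA ut scale1r.
rewrite mulrBr ut mulr1 addrAC subrr add0r //.
Qed.

Lemma hTiK k : (k < N)%N -> cancel (hTi k) (hT k).
Proof.
move=> hk f; rewrite /heckeTi linearB !linearZ /= hT_quad // scalerDr !scalerA ut.
by rewrite scale1r mulrBr ut mulr1 scalerN addrAC subrr add0r.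
Qed.

Lemma hT_hTi_braid k f : (k.+1 < N)%N ->
  hT k.+1 (hTi k (hTi k.+1 f)) = hTi k (hTi k.+1 (hT k f)).
Proof.
move=> hk; have hk' := ltnW hk; set g := hTi k (hTi k.+1 f).
have -> : f = hT k.+1 (hT k g) by rewrite !hTiK.
by rewrite hT_braid // !hTK.
Qed.

(** A form of the relation $T_kx_kT_k=t\,x_{k+1}$. *)
Lemma hTi_xr k f : (k < N)%N -> hTi k (xv k.+1 * f) = u *: (xv k * hT k f).
Proof.
move=> hk; apply: (can_inj (hTK hk)); rewrite hTiK // linearZ /= hT_xl //.
rewrite hT_quad // mulrDr -!scalerAr addrAC -scalerDl addrA subrK subrr.
by rewrite scale0r add0r scalerA ut scale1r.
Qed.

Lemma hTis_x m f : (m <= N)%N ->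
  hTis 0 m (xv m * f) = u ^+ m *: (xv 0 * hTs 0 m f).
Proof.
elim: m f => [|m IH] f hm; first by rewrite expr0 scale1r.
rewrite hTisSr add0n hTi_xr // linearZ /= IH ?(ltnW hm) // scalerA -exprS.
by rewrite hTsSr.
Qed.

(** The braid relation carries $T_{k+1}$ through the product as $T_k$. The cyclic shift changes the
    index in the same way ([w1_hT]), so the first Cherednik operator commutes with $T_{k+1}$. *)
Lemma hT_hTis_shift k f : (k.+1 < N)%N ->
  hT k.+1 (hTis 0 N f) = hTis 0 N (hT k f).
Proof.
move=> hk; have split g : hTis 0 N g = hTis 0 (k + (N - k.+2).+2) g.
  by congr hTis; lia.
rewrite !split !hTis_add add0n !hTisS hT_hTis_far //; try lia.
by rewrite hT_hTi_braid // hT_hTis_far //; lia.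
Qed.

End Products.

(** * Cherednik operators at q = 1 *)

Lemma telescope_ord (V : zmodType) (a : nat -> V) n :
  \sum_(i < n) (a i - a i.+1) = a 0 - a n.
Proof.
elim: n => [|n IH]; first by rewrite big_ord0 subrr.
by rewrite big_ord_recr /= IH addrA subrK.
Qed.

(* The sum of the r_i is central once r_(i+1) = u T_i r_i T_i and r_0 commutes
   with all T_j but T_0, as for the Cherednik operators. *)
Section AbstractHecke.

Context (R : comNzRingType) (t u : R) (ut : u * t = 1) (V : lmodType R) (N : nat).
Context (T r : nat -> V -> V).
Context (T_lin : forall k, linear (T k)) (r_lin : forall k, linear (r k)).
Context (T_quad : forall k f, (k < N)%N ->
  T k (T k f) = (t - 1) *: T k f + t *: f).
Context (T_far : forall j k f, (j.+1 < k)%N -> (k < N)%N ->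
  T j (T k f) = T k (T j f)).
Context (T_braid : forall k f, (k.+1 < N)%N ->
  T k (T k.+1 (T k f)) = T k.+1 (T k (T k.+1 f))).
Context (r_succ : forall i f, (i < N)%N -> r i.+1 f = u *: T i (r i (T i f))).
Context (r_zero : forall j f, (0 < j)%N -> (j < N)%N -> T j (r 0 f) = r 0 (T j f)).

Lemma linear_fun0 (F : V -> V) : linear F -> F 0 = 0.
Proof.
by move=> linF; have := linF (-1) 0 0; rewrite !scaleN1r oppr0 addr0 addNr.
Qed.

Lemma linear_funZ (F : V -> V) : linear F -> scalable F.
Proof.
by move=> linF c f; have := linF c f 0; rewrite !addr0 linear_fun0 ?addr0.
Qed.

Lemma succ_comm_gt i j f : (i < j)%N -> (j < N)%N -> T j (r i f) = r i (T j f).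
Proof.
elim: i j f => [|i IH] j f hij hj; first exact: r_zero.
have hi : (i < N)%N by lia.
have far h : T j (T i h) = T i (T j h) by rewrite -T_far.
by rewrite !r_succ // (linear_funZ (T_lin j)) far IH ?far // ltnW.
Qed.

Lemma succ_comm_lt i j f : (j.+1 < i)%N -> (i <= N)%N -> T j (r i f) = r i (T j f).
Proof.
elim: i f => [//|i IH] f; rewrite ltnS leq_eqVlt => /orP[/eqP <- {i IH} hi|hji hi].
  (* Here the operator is $r_{j+2}$: the braid relation turns $T_j$ into $T_{j+1}$, which commutes
     with $r_j$, and a second use turns it back. *)
  have hj := ltnW hi; rewrite !r_succ // !(linear_funZ (T_lin _)) T_braid //.
  by rewrite succ_comm_gt // -T_braid.
have far h : T j (T i h) = T i (T j h) by rewrite T_far.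
by rewrite !r_succ // (linear_funZ (T_lin j)) far IH ?far // ltnW.
Qed.

(** By the quadratic relation $T_jr_{j+1}=u(t-1)T_jr_jT_j+r_jT_j$ and
    $r_{j+1}T_j=u(t-1)T_jr_jT_j+T_jr_j$, so the defects of $r_j$ and $r_{j+1}$ cancel. *)
Lemma succ_comm_pair j f : (j < N)%N ->
  T j (r j f) + T j (r j.+1 f) = r j (T j f) + r j.+1 (T j f).
Proof.
move=> hj; rewrite !r_succ // (linear_funZ (T_lin j)) !T_quad // r_lin T_lin.
rewrite (linear_funZ (r_lin j)) (linear_funZ (T_lin j)) !scalerDr !scalerA ut.
by rewrite !scale1r addrCA [RHS]addrCA (addrC (r j (T j f))).
Qed.

Lemma succ_sum_comm j f : (j < N)%N ->
  T j (\sum_(i < N.+1) r i f) = \sum_(i < N.+1) r i (T j f).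
Proof.
move=> hj; apply/eqP; rewrite -subr_eq0.
have -> : T j (\sum_(i < N.+1) r i f) = \sum_(i < N.+1) T j (r i f).
  elim/big_rec2: _ => [|i x y _ <-]; first exact: linear_fun0.
  by rewrite -[r i f]scale1r T_lin !scale1r.
have lj : (j < N.+1)%N by lia.
rewrite -sumrB (bigD1 (Ordinal lj)) //=.
rewrite (bigD1 (Ordinal (hj : (j.+1 < N.+1)%N))) /=; last first.
  by rewrite -val_eqE /=; lia.
rewrite big1 => [|i /andP[]]; last first.
  rewrite -!val_eqE /= => n1 n2; apply/eqP; rewrite subr_eq0; apply/eqP.
  have := ltn_ord i; case: (ltngtP i j) n1 => // [lt_ij _ _|lt_ji _ hi].
    exact: succ_comm_gt.
  by apply: succ_comm_lt; lia.
by rewrite addr0 addrACA succ_comm_pair // -opprD subrr.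
Qed.

End AbstractHecke.

Lemma linear_commute_vars n (R : comNzRingType)
    (O : {mpoly R[n]} -> {mpoly R[n]}) f : linear O ->
  (forall (k : 'I_n) g, O ('X_k * g) = 'X_k * O g) -> O f = f * O 1.
Proof.
move=> linO xk; elim/mpolyind: f => [|c m f _ _ IH].
  by rewrite linear_fun0 // mul0r.
rewrite linO IH mulrDl -scalerAl; congr (_ *: _ + _).
have mono h : O ('X_[m] * h) = 'X_[m] * O h.
  rewrite mpolyXE_id; elim/big_rec: _ h => [h|k p _ IHp h]; first by rewrite !mul1r.
  rewrite -!mulrA -IHp; elim: (m k) => [|e IHe]; first by rewrite !mul1r.
  by rewrite exprS -!mulrA xk IHe.
by rewrite -mono mulr1.
Qed.

Section Cherednik.

Context (N : nat) (R : idomainType) (t u : R).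
Local Notation P := {mpoly R[N.+1]}.
Local Notation hT := (@heckeT N R t).
Local Notation hTi := (@heckeTi N R t u).
Local Notation hTs := (@hTs N R t).
Local Notation hTis := (@hTis N R t u).
Local Notation xv := (@varX N R).
Implicit Types (f g : P) (M : P -> P) (i j k : nat).

(* For M the identity this is Y_(i+1) at q = 1; for M = x_n d/dx_n it is the
   derivative of Y_(i+1) with respect to q at q = 1. *)
Definition cher M i f : P := u ^+ i *: hTis i (N - i) (M (w1 (hTs 0 i f))).

Context (ut : u * t = 1).

Section Multiplier.

Context (g : P) (sym_g : forall k, (k.+1 < N)%N -> sw k g = g).
Local Notation r := (cher (fun h => g * h)).

Lemma cher_mulS i f : (i < N)%N -> r i.+1 f = u *: hT i (r i (hT i f)).
Proof.
move=> hi; rewrite /cher -hTsSr.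
have -> : (N - i)%N = (N - i.+1).+1 by lia.
by rewrite hTisS [hT i _]linearZ /= hTiK // scalerA -exprS.
Qed.

Lemma cher_mul_is_linear i : linear (r i).
Proof.
move=> c f h; rewrite /cher !linearD /= !linearZ /= mulrDr -scalerAr linearD.
by rewrite scalerDr linearZ /= !scalerA mulrC.
Qed.

Lemma cher_mul0 f : r 0 f = hTis 0 N (g * w1 f).
Proof. by rewrite /cher expr0 scale1r subn0. Qed.

Local Opaque cher heckeT.

(** For $g=1$ this is $\sum_i Y_i$ at $q=1$; for $g=x_n\,\partial s/\partial x_n$ with $s$ symmetric
    it is the commutator of $\sum_i Y'_i$ with $s$. *)
Definition cher_sum f : P := \sum_(i < N.+1) r i f.

Lemma cher_sum_hT j f : (j < N)%N -> hT j (cher_sum f) = cher_sum (hT j f).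
Proof.
apply: (succ_sum_comm ut).
- exact: hT_is_linear.
- exact: cher_mul_is_linear.
- exact: hT_quad.
- exact: hT_far.
- exact: hT_braid.
- exact: cher_mulS.
move=> [//|k] h _ hk; rewrite !cher_mul0 (hT_hTis_shift ut _ hk).
by rewrite (hT_sym _ _ (ltnW hk)) ?w1_hT // sym_g.
Qed.

Local Transparent cher.

(** The correction is a difference of consecutive values of [w], so it telescopes over $i$. Both
    ends come from the operator of index 0, which sends [xv 0 * f] to [xv 0 * w N] and [f] to
    [w 0]. *)
Lemma cher_mul_x0 i f : (i < N)%N ->
  let w k := u ^+ k *: hTs 0 k (hTis k (N - k) (g * w1 f)) in
  r i.+1 (xv 0 * f) = xv 0 * r i.+1 f + xv 0 * (w i - w i.+1).
Proof.
move=> hi w.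
have sx k : (k <= N)%N -> forall j, (0 < j)%N -> (j + k <= N)%N ->
    forall h, hTis j k (xv 0 * h) = xv 0 * hTis j k h.
  move=> hk j hj hjk h; apply: hTis_sym => // l hl; apply: sw_xv => //; lia.
(* Moving $x_0$ past $T_0$ leaves one extra term in which $T_0$ is missing; it is the source of the
   correction. *)
have e1 : hTs 0 i.+1 (xv 0 * f) =
    xv 1 * hTs 0 i.+1 f + (1 - t) *: (xv 1 * hTs 1 i f).
  rewrite hTsS hTs_sym ?hT_xl //; first lia.
  by move=> l hl; apply: sw_xv => //; lia.
rewrite /cher e1 linearD linearZ /= !w1M w1_xvS ?(leq_ltn_trans _ hi) //.
have -> : w1 (hTs 1 i f) = hTs 0 i (w1 f) by rewrite w1_hTs.
rewrite mulrDr -scalerAr linearD linearZ /=.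
have e2 h : g * (xv 0 * h) = xv 0 * (g * h) by rewrite mulrCA.
rewrite !e2 !sx //; try lia.
rewrite scalerDr scalerAr; congr (_ + _).
rewrite scalerA scalerAr; congr (_ * _).
rewrite /w.
set K := hTis i.+1 (N - i.+1) (g * w1 f).
have -> : hTis i (N - i) (g * w1 f) = hTi i K by rewrite -hTisS subnSK.
have -> : hTis i.+1 (N - i.+1) (g * hTs 0 i (w1 f)) = hTs 0 i K.
  rewrite -hTs_sym; [|lia|by move=> k hk; apply: sym_g; lia].
  by rewrite hTs_hTis_far //; lia.
rewrite hTsSr /heckeTi linearB !linearZ /= scalerDr !scalerN !scalerA -exprSr.
rewrite addrAC subrr add0r -scaleNr; congr (_ *: _).
by rewrite exprSr mulrBr -[X in _ - X]mulrA ut !mulr1 -mulrN opprB mulrBr mulr1.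
Qed.

Local Opaque cher.

Lemma cher_sum_x0 f : cher_sum (xv 0 * f) = xv 0 * cher_sum f.
Proof.
rewrite /cher_sum !big_ord_recl mulrDr /=.
pose w k := u ^+ k *: hTs 0 k (hTis k (N - k) (g * w1 f)).
have -> : r 0 (xv 0 * f) = xv 0 * w N.
  rewrite cher_mul0 w1M w1_xv0 mulrCA hTis_x // /w subnn.
  by rewrite scalerAr.
have -> : r 0 f = w 0 by rewrite cher_mul0 /w expr0 scale1r subn0.
rewrite (eq_bigr (fun i : 'I_N => xv 0 * r (bump 0 i) f +
    (xv 0 * w i - xv 0 * w i.+1))); last first.
  by move=> i _; rewrite -mulrBr; apply: cher_mul_x0.
rewrite big_split /= -mulr_sumr (telescope_ord (fun k => xv 0 * w k)).
by rewrite addrCA [X in _ + X]addrC subrK addrC.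
Qed.

Lemma varX_succ k f : (k < N)%N -> xv k.+1 * f = u *: hT k (xv k * hT k f).
Proof.
by move=> hk; rewrite -(hTZ _ k u) -hTi_xr // hTiK.
Qed.

Lemma cher_sum_is_linear : linear cher_sum.
Proof.
move=> c f h; rewrite /cher_sum scaler_sumr -big_split /=.
by apply: eq_bigr => i _; rewrite cher_mul_is_linear.
Qed.

HB.instance Definition _ :=
  GRing.isLinear.Build R P P _ cher_sum cher_sum_is_linear.

(** Induction through $x_{k+1}=u\,T_kx_kT_k$, as the sum commutes with every $T_k$. *)
Lemma cher_sum_x k f : (k <= N)%N -> cher_sum (xv k * f) = xv k * cher_sum f.
Proof.
elim: k f => [|k IH] f hk; first exact: cher_sum_x0.
rewrite !varX_succ // linearZ /= -cher_sum_hT // IH ?(ltnW hk) //.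
by rewrite cher_sum_hT.
Qed.

Lemma cher_sum_scalar f : cher_sum f = f * cher_sum 1.
Proof.
apply: linear_commute_vars; first exact: cher_sum_is_linear.
move=> k h; have hk : (k <= N)%N by rewrite -ltnS.
by have := cher_sum_x h hk; rewrite /varX pos_val.
Qed.

Lemma cher_sum_sw k : (k < N)%N -> hT k (cher_sum 1) = t *: cher_sum 1.
Proof.
by move=> hk; rewrite cher_sum_hT // hT1 // -[t%:MP]mulr1 mul_mpolyC linearZ.
Qed.

End Multiplier.

End Cherednik.

(** * Triangularity *)

Section Supports.

Context (n : nat) (R : idomainType).
Implicit Types (f g : {mpoly R[n]}) (Q : 'X_{1..n} -> Prop).

Definition supp_in Q f := forall m, m \in msupp f -> Q m.

Lemma supp_in0 Q : supp_in Q 0.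
Proof. by move=> m; rewrite msupp0. Qed.

Lemma supp_inD Q f g : supp_in Q f -> supp_in Q g -> supp_in Q (f + g).
Proof.
by move=> Qf Qg m /msuppD_le; rewrite mem_cat => /orP[/Qf|/Qg].
Qed.

Lemma supp_inZ Q c f : supp_in Q f -> supp_in Q (c *: f).
Proof. by move=> Qf m /msuppZ_le/Qf. Qed.

Lemma supp_inN Q f : supp_in Q f -> supp_in Q (- f).
Proof. by rewrite -scaleN1r; apply: supp_inZ. Qed.

Lemma supp_in_sum Q (I : Type) (s : seq I) (F : I -> {mpoly R[n]}) :
  (forall i, supp_in Q (F i)) -> supp_in Q (\sum_(i <- s) F i).
Proof.
move=> QF; elim/big_rec: _ => [|i x _ Qx]; first exact: supp_in0.
exact: supp_inD.
Qed.

Lemma supp_inX Q m : Q m -> supp_in Q 'X_[m].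
Proof. by move=> Qm k /mem_msuppXP <-. Qed.

Lemma supp_in_impl Q1 Q2 f : (forall m, Q1 m -> Q2 m) -> supp_in Q1 f -> supp_in Q2 f.
Proof. by move=> h Qf m /Qf/h. Qed.

Lemma supp_in_linear Q1 Q2 (O : {mpoly R[n]} -> {mpoly R[n]}) f : linear O ->
  (forall m, Q1 m -> supp_in Q2 (O 'X_[m])) -> supp_in Q1 f -> supp_in Q2 (O f).
Proof.
move=> linO h Qf; rewrite (mpolyE f).
have -> (s : seq 'X_{1..n}) (c : 'X_{1..n} -> R) :
    O (\sum_(m <- s) c m *: 'X_[m]) = \sum_(m <- s) c m *: O 'X_[m].
  elim: s => [|m s IH]; first by rewrite !big_nil (linear_fun0 linO).
  by rewrite !big_cons linO IH.
rewrite big_seq; elim/big_rec: _ => [|m x mf Qx]; first exact: supp_in0.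
by apply: supp_inD => //; apply: supp_inZ; apply: h; apply: Qf.
Qed.

End Supports.

(** * Leading monomials of the operators *)

Section Triangularity.

Context (N : nat) (R : idomainType) (t u : R).
Local Notation P := {mpoly R[N.+1]}.
Local Notation hT := (@heckeT N R t).
Local Notation hTi := (@heckeTi N R t u).
Local Notation hTs := (@hTs N R t).
Local Notation hTis := (@hTis N R t u).
Local Notation xv := (@varX N R).
Implicit Types (f g : P) (F phi : nat -> nat) (m : 'X_{1..N.+1}).

Definition mF F : 'X_{1..N.+1} := [multinom F i | i < N.+1].

Lemma mF_pos F k : (k <= N)%N -> mF F (pos N k) = F k.
Proof. by move=> hk; rewrite mnmE posK. Qed.

Lemma mF_ext F G : (forall k, (k <= N)%N -> F k = G k) -> mF F = mF G.
Proof. by move=> e; apply/mnmP => i; rewrite !mnmE e // -ltnS. Qed.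

Lemma mFK m : mF (fun k => m (pos N k)) = m.
Proof. by apply/mnmP => i; rewrite mnmE pos_val. Qed.

Definition sqm m : nat := (\sum_(i < N.+1) m i * m i)%N.
Definition linm phi m : nat := (\sum_(i < N.+1) phi i * m i)%N.

(** The weights [phi] follow the exponents: when $T_k$ swaps two exponents of the leading monomial,
    the two weights are swapped too, so the key of that monomial does not change. In a Cherednik
    operator the weights start as the positions and return to them at the end. *)
Definition below phi d s l m : Prop :=
  mdeg m = d /\ ((sqm m < s)%N \/ sqm m = s /\ (linm phi m < l)%N).

Definition upd F k p q : nat -> nat :=
  fun j => if j == k then p else if j == k.+1 then q else F j.

Definition rest k F : P :=
  \prod_(i < N.+1 | (i != pos N k) && (i != pos N k.+1)) 'X_i ^+ F i.

Lemma big_two k (C : nat -> nat) : (k < N)%N ->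
  (\sum_(i < N.+1) C i =
   C k + (C k.+1 + \sum_(i < N.+1 | (i != pos N k) && (i != pos N k.+1)) C i))%N.
Proof.
move=> hk; rewrite (bigD1 (pos N k)) //= (bigD1 (pos N k.+1)) /=.
  by rewrite !posK // ltnW.
by rewrite pos_eq //; lia.
Qed.

Lemma mF_upd F k p q : (k < N)%N ->
  'X_[mF (upd F k p q)] = xv k ^+ p * (xv k.+1 ^+ q * rest k F).
Proof.
move=> hk; rewrite mpolyXE_id (bigD1 (pos N k)) //= (bigD1 (pos N k.+1)) /=.
  rewrite !mF_pos //; last exact: ltnW.
  rewrite /upd !eqxx (_ : k.+1 == k = false); last by lia.
  congr (_ * (_ * _)); apply: eq_bigr => i /andP[].
  rewrite -!val_eqE /= !posK // ?(ltnW hk) // => /negbTE e1 /negbTE e2.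
  by rewrite mnmE e1 e2.
by rewrite pos_eq //; lia.
Qed.

Lemma sqm_upd F k p q : (k < N)%N ->
  sqm (mF (upd F k p q)) = (p * p + (q * q +
  \sum_(i < N.+1 | (i != pos N k) && (i != pos N k.+1)) F i * F i))%N.
Proof.
move=> hk; rewrite /sqm; under eq_bigr do rewrite mnmE.
rewrite (big_two (fun j => upd F k p q j * upd F k p q j)%N hk).
rewrite {1 2 3 4}/upd !eqxx (_ : k.+1 == k = false); last by lia.
congr (_ + (_ + _))%N; apply: eq_bigr => i /andP[].
rewrite -!val_eqE /= !posK // ?(ltnW hk) // => /negbTE e1 /negbTE e2.
by rewrite /upd e1 e2.
Qed.

Lemma linm_upd phi r s F k p q : (k < N)%N ->
  linm (upd phi k r s) (mF (upd F k p q)) = (r * p + (s * q +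
  \sum_(i < N.+1 | (i != pos N k) && (i != pos N k.+1)) phi i * F i))%N.
Proof.
move=> hk; rewrite /linm; under eq_bigr do rewrite mnmE.
rewrite (big_two (fun j => upd phi k r s j * upd F k p q j)%N hk).
rewrite {1 2 3 4}/upd !eqxx (_ : k.+1 == k = false); last by lia.
congr (_ + (_ + _))%N; apply: eq_bigr => i /andP[].
rewrite -!val_eqE /= !posK // ?(ltnW hk) // => /negbTE e1 /negbTE e2.
by rewrite /upd e1 e2.
Qed.

Lemma mdeg_upd F k p q : (k < N)%N ->
  mdeg (mF (upd F k p q)) = (p + (q +
  \sum_(i < N.+1 | (i != pos N k) && (i != pos N k.+1)) F i))%N.
Proof.
move=> hk; rewrite mdegE; under eq_bigr do rewrite mnmE.
rewrite (big_two (upd F k p q) hk).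
rewrite {1 2}/upd !eqxx (_ : k.+1 == k = false); last by lia.
congr (_ + (_ + _))%N; apply: eq_bigr => i /andP[].
rewrite -!val_eqE /= !posK // ?(ltnW hk) // => /negbTE e1 /negbTE e2.
by rewrite /upd e1 e2.
Qed.

Lemma sw_rest F k : (k < N)%N -> sw k (rest k F) = rest k F.
Proof.
move=> hk; rewrite /sw /rest rmorph_prod; apply: eq_bigr => i /andP[h1 h2].
by rewrite rmorphXn /= msymXU tpermD // eq_sym.
Qed.

Lemma hT_pow_eq k b g : (k < N)%N -> sw k g = g ->
  hT k (xv k ^+ b * (xv k.+1 ^+ b * g)) = t *: (xv k ^+ b * (xv k.+1 ^+ b * g)).
Proof.
move=> hk sym_g; rewrite hT_invariant // mulrA -exprMn /sw rmorphM rmorphXn.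
rewrite rmorphM /= -/(sw k (xv k)) -/(sw k g) sw_xvl sym_g.
by rewrite -/(sw k (xv k.+1)) sw_xvr [xv k.+1 * _]mulrC.
Qed.

(** Induction on the difference of the exponents, by multiplication with $x_k$. Besides the swapped
    monomial, only exponents strictly between $b$ and $b+e+1$ occur, and these have a smaller sum of
    squares. *)
Lemma hT_pow_gt k b e g : (k < N)%N -> sw k g = g ->
  let X p q := xv k ^+ p * (xv k.+1 ^+ q * g) in
  hT k (X (b + e.+1)%N b) =
  X b (b + e.+1)%N + (1 - t) *: \sum_(j < e) X (b + (e - j))%N (b + j.+1)%N.
Proof.
move=> hk sym_g X.
have XS p q : X p.+1 q = xv k * X p q by rewrite /X exprS -mulrA.
have XSr p q : X p q.+1 = xv k.+1 * X p q by rewrite /X exprS -mulrA mulrCA.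
have diag : hT k (X b b) = t *: X b b by exact: hT_pow_eq.
elim: e => [|e IH].
  rewrite big_ord0 scaler0 addr0 !addn1 XS hT_xl // diag XSr -scalerAr -scalerDl.
  by rewrite addrC subrK scale1r.
rewrite addnS XS hT_xl // IH mulrDr -scalerAr -addrA -scalerDr.
rewrite -XSr -addnS; congr (_ + _ *: _).
rewrite big_ord_recl subn0 addrC addn1 XSr; congr (_ + _).
rewrite mulr_sumr; apply: eq_bigr => j _; rewrite -XSr /=.
by congr X; rewrite /bump /=; lia.
Qed.

Lemma hT_pow_lt k b e g : (k < N)%N -> sw k g = g ->
  let X p q := xv k ^+ p * (xv k.+1 ^+ q * g) in
  hT k (X b (b + e.+1)%N) =
  t *: X (b + e.+1)%N b + (t - 1) *: X b (b + e.+1)%N +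
  (t - 1) *: \sum_(j < e) X (b + (e - j))%N (b + j.+1)%N.
Proof.
move=> hk sym_g X.
have XS p q : X p.+1 q = xv k * X p q by rewrite /X exprS -mulrA.
have XSr p q : X p q.+1 = xv k.+1 * X p q by rewrite /X exprS -mulrA mulrCA.
have diag : hT k (X b b) = t *: X b b by exact: hT_pow_eq.
elim: e => [|e IH].
  rewrite big_ord0 scaler0 addr0 !addn1 XSr hT_xr // diag XS -scalerAr -XSr.
  by rewrite -scaleNr opprB.
rewrite addnS XSr hT_xr // IH !mulrDr -!scalerAr -XS -addnS -XSr -!addrA.
rewrite -scaleNr opprB; congr (_ + _); rewrite -!scalerDr; congr (_ *: _).
rewrite addrA [LHS]addrC; congr (_ + _).
rewrite big_ord_recr /= subSnn addn1 XS addrC; congr (_ + _).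
rewrite mulr_sumr; apply: eq_bigr => j _.
by rewrite -XS; congr X; have := ltn_ord j; lia.
Qed.

Definition swf k F := upd F k (F k.+1) (F k).

Lemma mF_updE F k : mF F = mF (upd F k (F k) (F k.+1)).
Proof.
by apply: mF_ext => j _; rewrite /upd; case: eqP => [->//|_]; case: eqP => [->|].
Qed.

Lemma linm_ext phi psi m : (forall k, (k <= N)%N -> phi k = psi k) ->
  linm phi m = linm psi m.
Proof. by move=> e; apply: eq_bigr => i _; rewrite e // -ltnS. Qed.

Lemma linm_updE phi k m : linm phi m = linm (upd phi k (phi k) (phi k.+1)) m.
Proof.
apply: linm_ext => j _; rewrite /upd.
by case: eqP => [->//|_]; case: eqP => [->|].
Qed.

Lemma key_swf phi F k : (k < N)%N ->
  [/\ mdeg (mF (swf k F)) = mdeg (mF F), sqm (mF (swf k F)) = sqm (mF F) &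
      linm (swf k phi) (mF (swf k F)) = linm phi (mF F)].
Proof.
move=> hk; rewrite (linm_updE phi k) (mF_updE F k) /swf.
by rewrite !mdeg_upd // !sqm_upd // !linm_upd //; split; lia.
Qed.

Lemma below_mid phi F k p q : (k < N)%N -> (p + q = F k + F k.+1)%N ->
  (minn (F k) (F k.+1) < p)%N -> (minn (F k) (F k.+1) < q)%N ->
  below (swf k phi) (mdeg (mF F)) (sqm (mF F)) (linm phi (mF F))
    (mF (upd F k p q)).
Proof.
move=> hk e hp hq; rewrite (mF_updE F k) /below !mdeg_upd // !sqm_upd //.
by split; [lia|left; nia].
Qed.

Lemma supp_in_mid phi F k e b : (k < N)%N ->
  minn (F k) (F k.+1) = b -> (F k + F k.+1 = b + b + e.+1)%N ->
  supp_in (below (swf k phi) (mdeg (mF F)) (sqm (mF F)) (linm phi (mF F)))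
   (\sum_(j < e) xv k ^+ (b + (e - j)) * (xv k.+1 ^+ (b + j.+1) * rest k F)).
Proof.
move=> hk h1 h2; apply: supp_in_sum => j; rewrite -mF_upd //; apply: supp_inX.
by apply: below_mid => //; have := ltn_ord j; lia.
Qed.

Lemma below_stay phi F k : (k < N)%N ->
  ((phi k < phi k.+1) && (F k < F k.+1) ||
   (phi k.+1 < phi k) && (F k.+1 < F k))%N ->
  below (swf k phi) (mdeg (mF F)) (sqm (mF F)) (linm phi (mF F)) (mF F).
Proof.
move=> hk h; rewrite (linm_updE phi k) (mF_updE F k) /below /swf !linm_upd //.
by split=> //; right; split=> //; nia.
Qed.

(** For $F_k<F_{k+1}$ the original monomial also occurs. It counts as lower since the swapped
    weights pair the larger weight with the smaller exponent, which is why [phi] increases here and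
    decreases for the inverse operator. *)
Lemma hT_mono phi F k : (k < N)%N -> (phi k < phi k.+1)%N ->
  supp_in (below (swf k phi) (mdeg (mF F)) (sqm (mF F)) (linm phi (mF F)))
    (hT k 'X_[mF F] - t ^+ (F k <= F k.+1)%N *: 'X_[mF (swf k F)]).
Proof.
move=> hk hphi; have Xupd := mF_upd F _ _ hk.
rewrite [in hT k _](mF_updE F k) /swf !Xupd.
case: (ltngtP (F k) (F k.+1)) => [lt_ab|lt_ba|eq_ab].
- have [e ee] : exists e, F k.+1 = (F k + e.+1)%N.
    by exists (F k.+1 - F k).-1; lia.
  rewrite ee (hT_pow_lt _ _ hk (sw_rest F hk)) expr1 addrC !addrA addNr add0r.
  apply: supp_inD; apply: supp_inZ; last by apply: supp_in_mid; lia.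
  rewrite -ee -Xupd -mF_updE; apply: supp_inX; apply: below_stay => //.
  by rewrite hphi lt_ab.
- have [e ee] : exists e, F k = (F k.+1 + e.+1)%N.
    by exists (F k - F k.+1).-1; lia.
  rewrite ee (hT_pow_gt _ _ hk (sw_rest F hk)) expr0 scale1r addrAC subrr add0r.
  by apply: supp_inZ; apply: supp_in_mid; lia.
- rewrite eq_ab expr1 hT_pow_eq ?sw_rest // subrr.
  exact: supp_in0.
Qed.

Lemma hTi_mono (ut : u * t = 1) phi F k : (k < N)%N -> (phi k.+1 < phi k)%N ->
  supp_in (below (swf k phi) (mdeg (mF F)) (sqm (mF F)) (linm phi (mF F)))
    (hTi k 'X_[mF F] - u ^+ (F k.+1 <= F k)%N *: 'X_[mF (swf k F)]).
Proof.
move=> hk hphi; have Xupd := mF_upd F _ _ hk.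
rewrite [in hTi k _](mF_updE F k) /swf !Xupd /heckeTi.
case: (ltngtP (F k) (F k.+1)) => [lt_ab|lt_ba|eq_ab].
- have [e ee] : exists e, F k.+1 = (F k + e.+1)%N.
    by exists (F k.+1 - F k).-1; lia.
  rewrite ee (hT_pow_lt _ _ hk (sw_rest F hk)) expr0 scale1r !scalerDr !scalerA.
  rewrite ut scale1r mulrBr ut mulr1.
  rewrite [X in X - _]addrAC addrK addrAC subrr add0r.
  by apply: supp_inZ; apply: supp_in_mid; lia.
- have [e ee] : exists e, F k = (F k.+1 + e.+1)%N.
    by exists (F k - F k.+1).-1; lia.
  rewrite ee (hT_pow_gt _ _ hk (sw_rest F hk)) expr1 !scalerDr !scalerA.
  rewrite addrAC [X in X - _ - _]addrC addrK.
  apply: supp_inD; first by apply: supp_inZ; apply: supp_in_mid; lia.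
  apply: supp_inN; apply: supp_inZ; rewrite -ee -Xupd -mF_updE.
  by apply: supp_inX; apply: below_stay => //; rewrite hphi lt_ba orbT.
- rewrite eq_ab expr1 hT_pow_eq ?sw_rest // scalerA ut -scalerBl -scalerBl.
  by rewrite opprB addrCA subrr addr0 subrr scale0r; exact: supp_in0.
Qed.

Lemma hT_below phi d s l f k : (k < N)%N -> (phi k < phi k.+1)%N ->
  supp_in (below phi d s l) f -> supp_in (below (swf k phi) d s l) (hT k f).
Proof.
move=> hk hphi; apply: supp_in_linear; first exact: hT_is_linear.
move=> m; have [F <-] : exists F, mF F = m by eexists; exact: mFK.
move=> [degm keym]; have [e1 e2 e3] := key_swf phi F hk.
rewrite -[hT k _](subrK (t ^+ (F k <= F k.+1)%N *: 'X_[mF (swf k F)])).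
apply: supp_inD.
  apply: supp_in_impl _ (@hT_mono phi F k hk hphi) => m'; rewrite /below degm; lia.
by apply: supp_inZ; apply: supp_inX; rewrite /below e1 e2 e3; split.
Qed.

Lemma hTi_below (ut : u * t = 1) phi d s l f k :
  (k < N)%N -> (phi k.+1 < phi k)%N ->
  supp_in (below phi d s l) f -> supp_in (below (swf k phi) d s l) (hTi k f).
Proof.
move=> hk hphi; apply: supp_in_linear; first exact: hTi_is_linear.
move=> m; have [F <-] : exists F, mF F = m by eexists; exact: mFK.
move=> [degm keym]; have [e1 e2 e3] := key_swf phi F hk.
rewrite -[hTi k _](subrK (u ^+ (F k.+1 <= F k)%N *: 'X_[mF (swf k F)])).
apply: supp_inD.
  apply: supp_in_impl _ (@hTi_mono ut phi F k hk hphi) => m'; rewrite /below degm; lia.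
by apply: supp_inZ; apply: supp_inX; rewrite /below e1 e2 e3; split.
Qed.

Lemma below_ext phi psi d s l f : (forall k, (k <= N)%N -> phi k = psi k) ->
  supp_in (below phi d s l) f -> supp_in (below psi d s l) f.
Proof.
by move=> e; apply: supp_in_impl => m; rewrite /below (linm_ext _ e).
Qed.

(* The letter of F in position i is moved left to position p. *)
Definition mvl i p F : nat -> nat := fun x =>
  if (x < p)%N then F x else if x == p then F i
  else if (x <= i)%N then F x.-1 else F x.

Lemma swf_mvl i p F x : (p < i)%N -> swf p (mvl i p.+1 F) x = mvl i p F x.
Proof.
by move=> hp; rewrite /swf /upd /mvl; repeat case: ifP => ?; congr F; lia.
Qed.

Lemma supp_in_step (O : P -> P) (Q Q' : 'X_{1..N.+1} -> Prop) f g h (c c' : R) :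
  linear O -> (forall e, supp_in Q e -> supp_in Q' (O e)) ->
  supp_in Q (f - c *: g) -> supp_in Q' (O g - c' *: h) ->
  supp_in Q' (O f - (c * c') *: h).
Proof.
move=> linO mono hf hg; rewrite -[f](subrK (c *: g)) [X in O X]addrC linO -scalerA.
rewrite addrAC -scalerBr.
by apply: supp_inD; [exact: supp_inZ|exact: mono].
Qed.

Lemma mvl_key i p F : (p <= i)%N -> (i <= N)%N ->
  [/\ mdeg (mF (mvl i p F)) = mdeg (mF F), sqm (mF (mvl i p F)) = sqm (mF F)
   & linm (mvl i p id) (mF (mvl i p F)) = linm id (mF F)].
Proof.
move=> le_pi hi; rewrite -(subKn le_pi); elim: (i - p)%N (leq_subr p i) => [|m IH] hm.
  rewrite subn0 [in linm (mvl _ _ _) _](@linm_ext _ id); last first.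
    by move=> k _; rewrite /mvl; repeat case: ifP => ?; lia.
  rewrite (@mF_ext _ F) // => k _.
  by rewrite /mvl; repeat case: ifP => ?; congr F; lia.
have [|<- <- <-] := IH; first exact: ltnW.
have e : (i - m = (i - m.+1).+1)%N by lia.
have hk : (i - m.+1 < N)%N by lia.
have lt : (i - m.+1 < i)%N by lia.
have [<- <- <-] := key_swf (mvl i (i - m) id) (mvl i (i - m) F) hk.
rewrite e (@mF_ext _ (mvl i (i - m.+1) F)); last by move=> k _; rewrite swf_mvl.
by rewrite (@linm_ext _ (mvl i (i - m.+1) id)) // => k _; rewrite swf_mvl.
Qed.

Lemma hTs_mono i (m : nat) F : (m <= i)%N -> (i <= N)%N ->
  let p := (i - m)%N in
  supp_in (below (mvl i p id) (mdeg (mF F)) (sqm (mF F)) (linm id (mF F)))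
    (hTs p m 'X_[mF F] -
     t ^+ (\sum_(p <= x < i) (F x <= F i))%N *: 'X_[mF (mvl i p F)]).
Proof.
move=> hm hi /=; elim: m hm => [|m IH] hm.
  rewrite subn0 big_geq // expr0 scale1r /= (@mF_ext _ F); last first.
    by move=> k _; rewrite /mvl; repeat case: ifP => ?; congr F; lia.
  by rewrite subrr; exact: supp_in0.
have e : (i - m = (i - m.+1).+1)%N by lia.
have {IH} := IH (ltnW hm); rewrite e; set p := (i - m.+1)%N => IH.
have hp : (p < i)%N by lia.
have hpN : (p < N)%N by lia.
rewrite hTsS big_ltn // addnC exprD.
have phip : (mvl i p.+1 id p < mvl i p.+1 id p.+1)%N.
  by rewrite /mvl ltnSn ltnn eqxx.
have fin (f : P) : supp_in (below (swf p (mvl i p.+1 id)) (mdeg (mF F)) (sqm (mF F))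
    (linm id (mF F))) f -> supp_in (below (mvl i p id) (mdeg (mF F)) (sqm (mF F))
    (linm id (mF F))) f.
  by apply: below_ext => k _; rewrite swf_mvl.
apply: (supp_in_step (hT_is_linear t p) _ IH).
  by move=> h /(hT_below hpN phip)/fin.
apply: fin; have := @hT_mono _ (mvl i p.+1 F) _ hpN phip.
have [-> -> ->] := mvl_key F hp hi.
rewrite (@mF_ext (swf p _) (mvl i p F)); last by move=> k _; rewrite swf_mvl.
rewrite (_ : mvl i p.+1 F p = F p); last by rewrite /mvl ltnSn.
by rewrite (_ : mvl i p.+1 F p.+1 = F i) // /mvl ltnn eqxx.
Qed.

Definition rotf F : nat -> nat := fun x => F (if x == N then 0 else x.+1)%N.

Lemma sum_rot (C : nat -> nat) :
  (\sum_(i < N.+1) rotf C i = \sum_(i < N.+1) C i)%N.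
Proof.
rewrite big_ord_recr [RHS]big_ord_recl /= /rotf eqxx addnC; congr (_ + _)%N.
by apply: eq_bigr => i _; rewrite ltn_eqF.
Qed.

Lemma rotf_key phi F :
  [/\ mdeg (mF (rotf F)) = mdeg (mF F), sqm (mF (rotf F)) = sqm (mF F) &
      linm (rotf phi) (mF (rotf F)) = linm phi (mF F)].
Proof.
rewrite !mdegE /sqm /linm; split; under eq_bigr do rewrite mnmE;
  under [RHS]eq_bigr do rewrite mnmE.
- exact: sum_rot.
- exact: (sum_rot (fun x => F x * F x)%N).
- exact: (sum_rot (fun x => phi x * F x)%N).
Qed.

Lemma w1_mono F : w1 'X_[mF F] = 'X_[mF (rotf F)] :> P.
Proof.
rewrite /w1 msymX; congr 'X_[_]; apply/mnmP => i; rewrite [LHS]mnmE [RHS]mnmE /rotf.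
have hi : (i <= N)%N by rewrite -ltnS.
case: (eqVneq (i : nat) N) => [eN|neN].
  by rewrite -[i]pos_val eN -cyc_pos0 permK mnmE posK.
have lt : (i < N)%N by rewrite ltn_neqAle neN.
by rewrite -{1}[i]pos_val -(cyc_posS lt) permK mnmE posK.
Qed.

Lemma w1_below phi d s l f :
  supp_in (below phi d s l) f -> supp_in (below (rotf phi) d s l) (w1 f).
Proof.
apply: supp_in_linear; first exact: w1_is_linear.
move=> m; have [F <-] : exists F, mF F = m by eexists; exact: mFK.
have [e1 e2 e3] := rotf_key phi F.
by rewrite w1_mono => h; apply: supp_inX; rewrite /below e1 e2 e3.
Qed.

(* The letter of F in position i is moved right to position p. *)
Definition mvr i p F : nat -> nat := fun x =>
  if (x < i)%N then F x else if (x < p)%N then F x.+1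
  else if x == p then F i else F x.

Lemma swf_mvr i p F x : (i <= p)%N -> swf p (mvr i p.+1 F) x = mvr i p F x.
Proof.
by move=> hp; rewrite /swf /upd /mvr; repeat case: ifP => ?; congr F; lia.
Qed.

Lemma mvr_id i F x : mvr i i F x = F x.
Proof. by rewrite /mvr; repeat case: ifP => ?; congr F; lia. Qed.

Lemma mvr_key i (m : nat) F : (i + m <= N)%N ->
  [/\ mdeg (mF (mvr i (i + m) F)) = mdeg (mF F),
      sqm (mF (mvr i (i + m) F)) = sqm (mF F)
    & linm (mvr i (i + m) id) (mF (mvr i (i + m) F)) = linm id (mF F)].
Proof.
elim: m => [|m IH] hm.
  rewrite addn0 (@mF_ext _ F); last by move=> k _; rewrite mvr_id.
  by rewrite (@linm_ext _ id) // => k _; rewrite mvr_id.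
have hk : (i + m < N)%N by lia.
have [|<- <- <-] := IH; first exact: ltnW.
have [<- <- <-] := key_swf (mvr i (i + m.+1) id) (mvr i (i + m.+1) F) hk.
rewrite addnS (@mF_ext _ (mvr i (i + m) F)); last first.
  by move=> k _; rewrite swf_mvr // leq_addr.
by rewrite (@linm_ext _ (mvr i (i + m) id)) // => k _; rewrite swf_mvr // leq_addr.
Qed.

Lemma hTis_mono (ut : u * t = 1) i (m : nat) F f c : (i + m <= N)%N ->
  supp_in (below (mvr i (i + m) id) (mdeg (mF F)) (sqm (mF F)) (linm id (mF F)))
    (f - c *: 'X_[mF (mvr i (i + m) F)]) ->
  supp_in (below id (mdeg (mF F)) (sqm (mF F)) (linm id (mF F)))
    (hTis i m f - (c * u ^+ (\sum_(i.+1 <= x < (i + m).+1) (F i <= F x))%N) *: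
     'X_[mF F]).
Proof.
elim: m f c => [|m IH] f c hm.
  rewrite addn0 big_geq // expr0 mulr1 /= (@mF_ext _ F); last first.
    by move=> k _; rewrite mvr_id.
  by apply: below_ext => k _; rewrite mvr_id.
rewrite addnS hTisSr; set p := (i + m)%N => hf.
have hp : (p < N)%N by lia.
have ip : (i <= p)%N by lia.
rewrite big_nat_recr /=; last by lia.
rewrite [(_ + (F i <= _))%N]addnC exprD mulrA; apply: IH; first exact: ltnW.
have phip : (mvr i p.+1 id p.+1 < mvr i p.+1 id p)%N.
  by rewrite /mvr; repeat case: ifP => ?; lia.
have fin (h : P) : supp_in (below (swf p (mvr i p.+1 id)) (mdeg (mF F)) (sqm (mF F))
    (linm id (mF F))) h -> supp_in (below (mvr i p id) (mdeg (mF F)) (sqm (mF F))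
    (linm id (mF F))) h.
  by apply: below_ext => k _; rewrite swf_mvr.
apply: (supp_in_step (hTi_is_linear t u p) _ hf).
  by move=> h /(hTi_below ut hp phip)/fin.
apply: fin; have := @hTi_mono ut _ (mvr i p.+1 F) _ hp phip.
have [] := @mvr_key i m.+1 F; first by lia.
rewrite addnS -/p => -> -> ->.
rewrite (@mF_ext (swf p _) (mvr i p F)); last by move=> k _; rewrite swf_mvr.
rewrite (_ : mvr i p.+1 F p.+1 = F i); last first.
  by rewrite /mvr; repeat case: ifP => ?; congr F; lia.
rewrite (_ : mvr i p.+1 F p = F p.+1) //.
by rewrite /mvr; repeat case: ifP => ?; congr F; lia.
Qed.

(** The exponent of $t^{-1}$ in $y_i$. *)
Definition rkf F i : nat :=
  (\sum_(0 <= x < i) (F i < F x) + \sum_(i.+1 <= x < N.+1) (F i <= F x))%N.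

(** The exponent in position $i$ is brought to the front by $T_0\cdots T_{i-1}$, sent to the last
    position by the cyclic shift, where [M] acts on it by [mu], and brought back by the inverse
    operators. Each exponent that it passes contributes a power of $t$ or $u$. *)
Lemma cher_mono (ut : u * t = 1) (M : P -> P) (mu : nat -> R) i F : linear M ->
  (forall m, M 'X_[m] = mu (m (pos N N)) *: 'X_[m]) -> (i <= N)%N ->
  supp_in (below id (mdeg (mF F)) (sqm (mF F)) (linm id (mF F)))
    (cher t u M i 'X_[mF F] - (u ^+ rkf F i * mu (F i)) *: 'X_[mF F]).
Proof.
move=> linM diagM hi; rewrite /cher.
have M_below phi d s l f : supp_in (below phi d s l) f ->
    supp_in (below phi d s l) (M f).
  apply: supp_in_linear => // m hm; rewrite diagM.
  by apply: supp_inZ; apply: supp_inX.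
have rot_mvl G x : (x <= N)%N -> rotf (mvl i 0 G) x = mvr i N G x.
  move=> hx; rewrite /rotf; case: eqP => [->|ne].
    by rewrite /mvl /mvr /=; repeat case: ifP => ?; congr G; lia.
  by rewrite /mvl /mvr /=; repeat case: ifP => ?; congr G; lia.
have := @hTs_mono i i F (leqnn i) hi; rewrite subnn => h1.
have {h1} : supp_in (below (mvr i (i + (N - i)) id)
    (mdeg (mF F)) (sqm (mF F)) (linm id (mF F)))
    (M (w1 (hTs 0 i 'X_[mF F])) - (t ^+ (\sum_(0 <= x < i) (F x <= F i))%N *
      mu (F i)) *: 'X_[mF (mvr i (i + (N - i)) F)]).
  rewrite subnKC //; apply: (supp_in_step (O := fun f => M (w1 f)) _ _ h1).
  - by move=> c f g; rewrite /= w1_is_linear linM.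
  - move=> e /w1_below/M_below; apply: below_ext => k hk.
    exact: rot_mvl.
  - rewrite /= w1_mono (mF_ext (rot_mvl F)) diagM mF_pos //.
    rewrite (_ : mvr i N F N = F i) ?subrr; first exact: supp_in0.
    by rewrite /mvr; repeat case: ifP => ?; congr F; lia.
move/(hTis_mono ut); rewrite subnKC // => /(_ (leqnn N)).
move/(supp_inZ (c := u ^+ i)); rewrite scalerBr scalerA.
congr (supp_in _ (_ - _ *: _)); rewrite /rkf exprD.
(* Of the $i$ earlier parts, those at most $F_i$ have contributed a factor $t$ each, cancelled by
   $u^i$; the larger ones leave a factor $u$ each. *)
have -> : u ^+ i = u ^+ (\sum_(0 <= x < i) (F i < F x))%N *
    u ^+ (\sum_(0 <= x < i) (F x <= F i))%N.
  rewrite -exprD -big_split /=; congr (u ^+ _).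
  rewrite (eq_bigr (fun=> 1%N)) => [|x _]; first by rewrite sum_nat_const_nat; lia.
  by case: leqP.
set a := (\sum_(0 <= x < i) (F x <= F i))%N.
have e : u ^+ a * t ^+ a = 1 by rewrite -exprMn ut expr1n.
by rewrite -!mulrA (mulrA (u ^+ a)) e mul1r [mu _ * _]mulrC.
Qed.

End Triangularity.

(** * Ranks of the parts of a composition *)

Section Ranks.

Context (n : nat).
Implicit Types (m : 'X_{1..n}) (i j k : 'I_n) (S : {set 'I_n}).

Definition beats m j i := (m i < m j)%N || (m i == m j) && (i < j)%N.

Definition rk m i : nat :=
  (#|[set j : 'I_n | (i < j)%N && (m i <= m j)%N]| +
   #|[set j : 'I_n | (j < i)%N && (m i < m j)%N]|)%N.

Lemma rkE m i : rk m i = #|[set j | beats m j i]|.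
Proof.
rewrite /rk -cardsUI; set A := _ :|: _; set B := _ :&: _.
have -> : B = set0 by apply/setP => j; rewrite !inE; lia.
rewrite cards0 addn0; congr #|pred_of_set _|.
apply/setP => j; rewrite !inE /beats.
by case: (eqVneq i j) => [->|]; rewrite -?val_eqE /=; lia.
Qed.

Lemma beats_trans m i j k : beats m i j -> beats m j k -> beats m i k.
Proof. by rewrite /beats; lia. Qed.

Lemma beats_irr m i : beats m i i = false.
Proof. by rewrite /beats; lia. Qed.

Lemma beats_total m i j : i != j -> beats m i j || beats m j i.
Proof. by rewrite /beats -val_eqE /=; lia. Qed.

Lemma rk_lt m i j : beats m i j -> (rk m i < rk m j)%N.
Proof.
move=> bij; rewrite !rkE; apply/proper_card/properP; split.
  by apply/subsetP => k; rewrite !inE => /beats_trans; apply.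
by exists i; rewrite !inE // beats_irr.
Qed.

Lemma rk_inj m : injective (rk m).
Proof.
move=> i j e; apply/eqP; apply: contraT => /(beats_total m).
by case/orP => /rk_lt; rewrite e ltnn.
Qed.

Definition upset m S := forall i j, i \in S -> j \notin S -> beats m i j.

Lemma upset_rk m S i : upset m S -> i \in S -> (rk m i < #|S|)%N.
Proof.
move=> upS iS; rewrite rkE [X in (_ < X)%N](cardsD1 i) iS add1n ltnS.
apply/subset_leq_card/subsetP => j; rewrite !inE => bji.
apply/andP; split; first by apply: contraTneq bji => ->; rewrite beats_irr.
apply: contraT => jS; have := beats_trans bji (upS _ _ iS jS).
by rewrite beats_irr.
Qed.

(** Ranks are distinct, and those in an upper set of size $k$ are below $k$, so they are exactly
    $0,\dots,k-1$. *)
Lemma upset_sum (R : comNzRingType) (u : R) m S : upset m S ->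
  \sum_(i in S) u ^+ rk m i = \sum_(j < #|S|) u ^+ j.
Proof.
move=> upS; rewrite -(big_mkord xpredT (fun x => u ^+ x)) -big_enum /=.
rewrite -(big_map (rk m) xpredT (fun x => u ^+ x)); apply: perm_big.
apply: uniq_perm; first by rewrite map_inj_uniq ?enum_uniq //; exact: rk_inj.
  exact: iota_uniq.
have uniq_rk : uniq [seq rk m i | i <- enum S].
  by rewrite map_inj_uniq ?enum_uniq //; exact: rk_inj.
have [||_ //] := uniq_min_size uniq_rk (s2 := index_iota 0 #|S|).
- move=> x /mapP[i]; rewrite mem_enum => iS ->.
  by rewrite mem_index_iota upset_rk.
by rewrite size_map size_iota subn0 -cardE.
Qed.

(** Raising an upper set by 1 only widens its distance to the other parts and keeps all differences
    inside and outside it. *)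
Lemma beats_add m S i j : upset m S ->
  beats (m + mesym1 S)%MM i j = beats m i j.
Proof.
move=> upS; case: (eqVneq i j) => [->|ne]; first by rewrite !beats_irr.
rewrite /beats !mnmDE !mnmE.
have := upS i j; have := upS j i; have := beats_total m ne; rewrite /beats.
case: (i \in S); case: (j \in S) => /=; lia.
Qed.

Lemma rk_add m S i : upset m S -> rk (m + mesym1 S)%MM i = rk m i.
Proof.
move=> upS; rewrite !rkE; congr #|pred_of_set _|.
by apply/setP => j; rewrite !inE beats_add.
Qed.

Lemma upset_add m S : upset m S -> upset (m + mesym1 S)%MM S.
Proof. by move=> upS i j iS jS; rewrite beats_add //; apply: upS. Qed.

Lemma upset_setT m : upset m setT.
Proof. by move=> i j _; rewrite inE. Qed.

End Ranks.

Lemma rkfE N (m : 'X_{1..N.+1}) (i : 'I_N.+1) :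
  rkf N (fun k => m (pos N k)) i = rk m i.
Proof.
have card_sum (A : nat -> bool) :
    (#|[set j : 'I_N.+1 | A j]| = \sum_(0 <= x < N.+1) A x)%N.
  rewrite -sum1_card big_mkcond big_mkord /=.
  by apply: eq_bigr => j _; rewrite inE; case: (A j).
have split (A : nat -> nat) : (\sum_(0 <= x < N.+1) A x =
    \sum_(0 <= x < i) A x + \sum_(i <= x < N.+1) A x)%N.
  by rewrite (big_cat_nat (n := i)) //= ltnW.
pose F k := m (pos N k).
have e1 : #|[set j : 'I_N.+1 | (j < i)%N && (m i < m j)%N]| =
    (\sum_(0 <= x < i) (F i < F x))%N.
  rewrite -[RHS]addn0.
  transitivity #|[set j : 'I_N.+1 | (j < i)%N && (F i < F j)%N]|.
    by congr #|pred_of_set _|; apply/setP => j; rewrite !inE /F !pos_val.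
  rewrite (card_sum (fun j => (j < i)%N && (F i < F j)%N)) split.
  congr (_ + _)%N; last first.
    by rewrite big_nat big1 // => x /andP[hx _]; rewrite ltnNge hx.
  by rewrite !big_nat; apply: eq_bigr => x /andP[_ ->].
have e2 : #|[set j : 'I_N.+1 | (i < j)%N && (m i <= m j)%N]| =
    (\sum_(i.+1 <= x < N.+1) (F i <= F x))%N.
  transitivity #|[set j : 'I_N.+1 | (i < j)%N && (F i <= F j)%N]|.
    by congr #|pred_of_set _|; apply/setP => j; rewrite !inE /F !pos_val.
  rewrite (card_sum (fun j => (i < j)%N && (F i <= F j)%N)) split.
  rewrite (big_ltn (ltn_ord i)) ltnn add0n big_nat big1 ?add0n; last first.
    by move=> x /andP[_ hx]; rewrite ltnNge ltnW.
  by rewrite !big_nat; apply: eq_bigr => x /andP[-> _].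
by rewrite /rkf /rk e1 e2 addnC.
Qed.

(** * Eigenvectors at q = 1 *)

Lemma exists_max_seq (T : eqType) (s : seq T) (k1 k2 : T -> nat) : s != [::] ->
  exists2 x, x \in s & forall y, y \in s ->
    (k1 y < k1 x)%N \/ k1 y = k1 x /\ (k2 y <= k2 x)%N.
Proof.
elim: s => [//|x s IH] _; case: s IH => [_|z s IH].
  by exists x; rewrite ?mem_head // => y; rewrite inE => /eqP ->; right.
have [//|y ys ymax] := IH.
have [lexy|ltyx] := boolP ((k1 x < k1 y) || (k1 x == k1 y) && (k2 x <= k2 y))%N.
  exists y; first by rewrite inE ys orbT.
  by move=> v; rewrite inE => /orP[/eqP ->|/ymax //]; lia.
exists x; first exact: mem_head.
by move=> v; rewrite inE => /orP[/eqP ->|/ymax]; lia.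
Qed.

(** * The Euler operator in the last variable *)

Section EulerOperator.

Context (N : nat) (R : idomainType).
Local Notation P := {mpoly R[N.+1]}.
Implicit Types (f g s : P) (m : 'X_{1..N.+1}).

Definition theta f : P := 'X_(pos N N) * f^`M(pos N N).

Lemma theta_is_linear : linear theta.
Proof. by move=> c f g; rewrite /theta linearP /= mulrDr -scalerAr. Qed.

HB.instance Definition _ := GRing.isLinear.Build R P P _ theta theta_is_linear.

Lemma thetaM f g : theta (f * g) = theta f * g + f * theta g.
Proof.
rewrite /theta mderivM mulrDr; congr (_ + _); [exact: mulrA|exact: mulrCA].
Qed.

Lemma thetaX m : theta 'X_[m] = (m (pos N N))%:R *: 'X_[m].
Proof.
rewrite /theta mderivX -scalerAr -mpolyXD.
case: (posnP (m (pos N N))) => [->|gt0]; first by rewrite !scale0r.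
congr (_ *: 'X_[_]); apply/mnmP => i; rewrite mnmDE mnmBE mnm1E.
by case: eqVneq => [<-|]; lia.
Qed.

Lemma mcoeff_theta f m : (theta f)@_m = (m (pos N N))%:R * f@_m.
Proof.
elim/mpolyind: f => [|c k f _ _ IH]; first by rewrite linear0 mcoeff0 mulr0.
rewrite linearP /= thetaX !mcoeffD !mcoeffZ IH mcoeffX mulrDr; congr (_ + _).
by case: eqVneq => [->|]; rewrite ?mulr0 // mulr1 mulrC mulr1.
Qed.

Lemma sw_symmetric s k : s \is symmetric -> sw k s = s.
Proof. by move/issymP => h; apply: h. Qed.

Lemma w1_symmetric s : s \is symmetric -> w1 s = s.
Proof. by move/issymP => h; apply: h. Qed.

Lemma sw_theta s k : s \is symmetric -> (k.+1 < N)%N -> sw k (theta s) = theta s.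
Proof.
move=> sym_s hk; apply/mpolyP => m; rewrite mcoeff_sym !mcoeff_theta.
rewrite -[s in RHS](sw_symmetric k sym_s) mcoeff_sym mnmE tpermD //.
  by rewrite pos_eq //; lia.
by rewrite pos_eq //; lia.
Qed.

End EulerOperator.

Section AtOne.

Context (N : nat) (R : idomainType) (t u : R).
Local Notation P := {mpoly R[N.+1]}.
Local Notation hTs := (@hTs N R t).
Local Notation hTis := (@hTis N R t u).
Local Notation Y := (cher t u (@id P)).
Local Notation theta := (@theta N R).
Implicit Types (f g s : P) (m nu : 'X_{1..N.+1}) (S : {set 'I_N.+1}).

Definition dY f : P := \sum_(i < N.+1) cher t u theta i f.

Lemma cher_is_linear (M : P -> P) i : linear M -> linear (cher t u M i).
Proof.
move=> linM c f g; rewrite /cher (hTs_is_linear t 0 i) w1_is_linear linM.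
rewrite (hTis_is_linear t u i) scalerDr !scalerA; congr (_ *: _ + _).
by rewrite mulrC.
Qed.

Lemma Y_is_linear i : linear (Y i).
Proof. by apply: cher_is_linear => c f g. Qed.

Lemma dY_is_linear : linear dY.
Proof.
move=> c f g; rewrite /dY scaler_sumr -big_split /=; apply: eq_bigr => i _.
by rewrite cher_is_linear //; exact: theta_is_linear.
Qed.

HB.instance Definition _ := GRing.isLinear.Build R P P _ dY dY_is_linear.

Lemma cher_mul_sym (M : P -> P) (i : 'I_N.+1) s f : s \is symmetric ->
  cher t u M i (s * f) =
  u ^+ i *: hTis i (N - i) (M (s * w1 (hTs 0 i f))).
Proof.
move=> sym_s; have hi : (0 + i <= N)%N by have := ltn_ord i; lia.
have sw_s k : (0 <= k < 0 + i)%N -> sw k s = s by move=> _; exact: sw_symmetric.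
by rewrite /cher (hTs_sym _ _ hi sw_s) w1M w1_symmetric.
Qed.

Lemma hTis_mul_sym (i : 'I_N.+1) s f : s \is symmetric ->
  hTis i (N - i) (s * f) = s * hTis i (N - i) f.
Proof.
move=> sym_s; apply: hTis_sym; first by have := ltn_ord i; lia.
by move=> k _; apply: sw_symmetric.
Qed.

Lemma Y_mul_sym (i : 'I_N.+1) s f : s \is symmetric -> Y i (s * f) = s * Y i f.
Proof. by move=> sym_s; rewrite cher_mul_sym // hTis_mul_sym // scalerAr. Qed.

(** This is the Leibniz rule for [theta], since all other factors of [cher] commute with $s$. *)
Lemma dY_mul_sym s f : s \is symmetric ->
  dY (s * f) = s * dY f + cher_sum t u (theta s) f.
Proof.
move=> sym_s; rewrite /dY /cher_sum mulr_sumr -big_split /=.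
apply: eq_bigr => i _; rewrite cher_mul_sym // thetaM [X in hTis _ _ X]addrC.
rewrite -[s * theta _]scale1r hTis_is_linear scale1r hTis_mul_sym //.
by rewrite scalerDr scalerAr.
Qed.

Context (ut : u * t = 1).

Definition below_self m := @below N id (mdeg m) (sqm m) (linm id m).

(** Nothing lies below the constant monomial, so 1 is an exact eigenvector of every triangular
    operator. *)
Lemma not_below_self0 m : ~ below_self 0%MM m.
Proof.
have sq0 : sqm (0%MM : 'X_{1..N.+1}) = 0%N.
  by rewrite /sqm big1 // => i _; rewrite mnm0E.
have l0 : linm id (0%MM : 'X_{1..N.+1}) = 0%N.
  by rewrite /linm big1 // => i _; rewrite mnm0E muln0.
by rewrite /below_self /below sq0 l0 => -[_ [|[_]]].
Qed.

Lemma Y_tri (i : 'I_N.+1) m :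
  supp_in (below_self m) (Y i 'X_[m] - u ^+ rk m i *: 'X_[m]).
Proof.
have hi : (i <= N)%N by rewrite -ltnS.
have h := @cher_mono N R t u ut id (fun=> 1) i (fun k => m (pos N k)) _ _ hi.
rewrite mFK rkfE mulr1 in h; apply: h; first by move=> c f g.
by move=> k; rewrite scale1r.
Qed.

Lemma dY_tri m : supp_in (below_self m)
  (dY 'X_[m] - (\sum_(i < N.+1) u ^+ rk m i * (m i)%:R) *: 'X_[m]).
Proof.
rewrite /dY scaler_suml -sumrB; apply: supp_in_sum => i.
have hi : (i <= N)%N by rewrite -ltnS.
have h := @cher_mono N R t u ut theta (fun k => k%:R) i
  (fun k => m (pos N k)) (@theta_is_linear N R) (@thetaX N R) hi.
by rewrite mFK rkfE pos_val in h.
Qed.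

(** Lower terms of the other monomials of $f$ cannot reach [z], so only the diagonal entry at [z]
    contributes. *)
Lemma tri_coef (O : P -> P) (c : 'X_{1..N.+1} -> R) f z : linear O ->
  (forall m, supp_in (below_self m) (O 'X_[m] - c m *: 'X_[m])) ->
  (forall m, m \in msupp f -> ~ below_self m z) ->
  (O f)@_z = c z * f@_z.
Proof.
move=> linO tri zmax; rewrite (mpolyE f).
have -> (l : seq 'X_{1..N.+1}) (b : 'X_{1..N.+1} -> R) :
    O (\sum_(m <- l) b m *: 'X_[m]) = \sum_(m <- l) b m *: O 'X_[m].
  elim: l => [|m l IH]; first by rewrite !big_nil (linear_fun0 linO).
  by rewrite !big_cons linO IH.
rewrite !raddf_sum mulr_sumr /= !big_seq; apply: eq_bigr => m mf.
rewrite !mcoeffZ mcoeffX -[O _](subrK (c m *: 'X_[m])) mcoeffD mcoeffZ mcoeffX.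
rewrite (memN_msupp_eq0 (m := z)); last by apply/negP => /tri/zmax; apply.
by rewrite add0r; case: eqVneq => [->|]; rewrite ?mulr0 // !mulr1 mulrC.
Qed.

End AtOne.

(** * The sum of the $Y'_i$ on elementary symmetric polynomials *)

Section ElementarySymmetric.

Context (N : nat) (R : idomainType) (t u : R) (ut : u * t = 1).
Local Notation P := {mpoly R[N.+1]}.
Local Notation hT := (@heckeT N R t).
Local Notation theta := (@theta N R).
Local Notation dY := (@dY N R t u).
Local Notation e := (mesym N.+1 R).
Implicit Types (f g s : P) (m nu : 'X_{1..N.+1}) (h S : {set 'I_N.+1}).

(** The equation says $(t x_k-x_{k+1})(f-s_kf)=0$, and the first factor is nonzero because $x_{k+1}$
    has coefficient $-1$ in it. *)
Lemma hT_eigen_sw k f : (k < N)%N -> hT k f = t *: f -> sw k f = f.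
Proof.
move=> hk e; have := hTE t f hk; rewrite e -scalerAr => /eqP.
rewrite -subr_eq0 opprB addrCA subrr addr0 mulf_eq0 => /orP[|]; last first.
  by rewrite subr_eq0 => /eqP.
have ne : pos N k != pos N k.+1 by apply: pos_neq; lia.
move/eqP/(congr1 (mcoeff U_(pos N k.+1))).
rewrite mcoeffB mcoeffZ !mcoeffXU (negbTE ne) eqxx mulr0 sub0r mcoeff0.
by move/eqP; rewrite oppr_eq0 oner_eq0.
Qed.

Lemma max_nondecreasing f z : (forall k, (k < N)%N -> sw k f = f) ->
  z \in msupp f -> (forall m, m \in msupp f -> (linm id m <= linm id z)%N) ->
  forall k, (k < N)%N -> (z (pos N k) <= z (pos N k.+1))%N.
Proof.
move=> sym_f zf zmax k hk; rewrite leqNgt; apply/negP => lt.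
pose F j := z (pos N j); have FK : mF N F = z := mFK z.
have zs : mF N (swf k F) \in msupp f.
  rewrite mcoeff_msupp -(sym_f k hk) mcoeff_sym -mcoeff_msupp.
  have -> : [multinom mF N (swf k F) (tr N k i) | i < N.+1] = z; last by [].
  rewrite -FK; apply/mnmP => i; rewrite [LHS]mnmE !mnmE.
  have hk' : (k <= N)%N by lia.
  rewrite /swf /upd; case: tpermP => [->|->|/eqP h1 /eqP h2].
  - by rewrite !posK // eqxx; case: eqP => // ?; lia.
  - by rewrite !posK // eqxx.
  - move: h1 h2; rewrite -!val_eqE /= !posK // => /negbTE -> /negbTE -> //.
have := zmax _ zs; rewrite -FK (linm_updE id k (mF N (swf k F))).
rewrite (linm_updE id k (mF N F)) (mF_updE N F k) /swf !linm_upd //.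
by rewrite -/(F k) -/(F k.+1) in lt; nia.
Qed.

Lemma nondecreasing_le m (i j : 'I_N.+1) :
  (forall k, (k < N)%N -> (m (pos N k) <= m (pos N k.+1))%N) ->
  (i <= j)%N -> (m i <= m j)%N.
Proof.
move=> nd le_ij; rewrite -[i]pos_val -[j]pos_val.
have : (j <= N)%N by rewrite -ltnS.
rewrite -(subnKC le_ij); elim: (j - i)%N => [|d IH]; first by rewrite addn0.
by rewrite addnS => hd; apply: leq_trans (IH (ltnW hd)) (nd _ hd).
Qed.

Lemma nondecreasing_bool_eq m m' :
  (forall k, (k < N)%N -> (m (pos N k) <= m (pos N k.+1))%N) ->
  (forall k, (k < N)%N -> (m' (pos N k) <= m' (pos N k.+1))%N) ->
  (forall i, (m i <= 1)%N) -> (forall i, (m' i <= 1)%N) ->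
  mdeg m = mdeg m' -> m = m'.
Proof.
have half m1 m2 : (forall k, (k < N)%N -> (m1 (pos N k) <= m1 (pos N k.+1))%N) ->
    (forall k, (k < N)%N -> (m2 (pos N k) <= m2 (pos N k.+1))%N) ->
    (forall i, (m1 i <= 1)%N) -> (forall i, (m2 i <= 1)%N) ->
    mdeg m1 = mdeg m2 -> forall i, (m2 i <= m1 i)%N.
  move=> nd1 nd2 b1 b2 deg i; rewrite leqNgt; apply/negP => lt.
  have : (mdeg m1 < mdeg m2)%N; last by rewrite deg ltnn.
  rewrite !mdegE (bigD1 i) //= [X in (_ < X)%N](bigD1 i) //=.
  rewrite -addSn leq_add // leq_sum // => j _.
  case: (leqP j i) => [/(nondecreasing_le nd1)|/ltnW/(nondecreasing_le nd2)].
    by have := b2 i; lia.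
  by have := b1 j; have := b2 i; lia.
move=> nd nd' b b' deg; apply/mnmP => i; apply/eqP.
by rewrite eqn_leq !half.
Qed.

Lemma sqm_mesym1 h : sqm (mesym1 h) = #|h|.
Proof.
rewrite /sqm -mdeg_mesym1 mdegE; apply: eq_bigr => i _.
by rewrite mnmE; case: (i \in h).
Qed.

Lemma bool_of_sqm m : (sqm m <= mdeg m)%N -> forall i, (m i <= 1)%N.
Proof.
move=> le i; rewrite leqNgt; apply/negP => gt.
have : (mdeg m < sqm m)%N; last by rewrite ltnNge le.
rewrite mdegE /sqm (bigD1 i) //= [X in (_ < X)%N](bigD1 i) //= -addSn leq_add //.
  by nia.
by apply: leq_sum => j _; nia.
Qed.

Lemma upset_mesym1 h : upset (mesym1 h) h.
Proof. by move=> i j ih jh; rewrite /beats !mnmE ih (negbTE jh). Qed.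

Lemma msupp_mesym1 k m : m \in msupp (e k) -> exists2 h : {set 'I_N.+1}, #|h| = k & m = mesym1 h.
Proof.
rewrite mcoeff_msupp mesymE raddf_sum /= => nz.
have [h /eqP hk hm] : exists2 h : {set 'I_N.+1}, #|h| == k & mesym1 h == m.
  apply/exists_inP; apply: contraNT nz; rewrite negb_exists_in => /forall_inP none.
  by rewrite big1 // => h /none; rewrite mcoeffX => /negbTE ->.
by exists h => //; rewrite (eqP hm).
Qed.

Lemma mcoeff_mesym1 k h : #|h| = k -> (e k)@_(mesym1 h) = 1.
Proof.
move=> hk; rewrite mesymE raddf_sum /= (bigD1 h) ?hk //= mcoeffX eqxx big1 ?addr0 //.
move=> h' /andP[_ ne]; rewrite mcoeffX; case: eqP => // /(@inj_mesym1 _ h' h).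
by move/eqP; rewrite (negbTE ne).
Qed.

Lemma dY1 : dY 1 = 0.
Proof.
have := @dY_tri N R t u ut 0%MM; rewrite big1 ?scale0r ?subr0 ?mpolyX0; last first.
  by move=> i _; rewrite mnm0E mulr0.
move=> h; apply/mpolyP => m; rewrite mcoeff0; apply: memN_msupp_eq0.
by apply/negP => /h; exact: not_below_self0.
Qed.

Lemma dY_mesym_sw k j : (j < N)%N -> sw j (dY (e k)) = dY (e k).
Proof.
move=> hj; apply: hT_eigen_sw => //.
have sym_e : e k \is symmetric := mesym_sym _ _ _.
have -> : dY (e k) = cher_sum t u (theta (e k)) 1.
  by rewrite -{1}[e k]mulr1 dY_mul_sym // dY1 mulr0 add0r.
by apply: cher_sum_sw => // l hl; apply: sw_theta.
Qed.

(** The difference [r] of the two sides is symmetric, and by triangularity its exponents have degree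
    $k$ and sum of squares at most $k$, so they are 0-1 vectors. If [r] were nonzero, symmetry would
    make its monomial of largest [linm id] the one with exponent $(0,\dots,0,1,\dots,1)$; but there
    the coefficient of [r] is the diagonal entry minus [eps], which is zero. *)
Lemma dY_mesym k : (k <= N.+1)%N -> dY (e k) = (\sum_(j < k) u ^+ j) *: e k.
Proof.
move=> hk; set eps := \sum_(j < k) _; apply/eqP; rewrite -subr_eq0.
apply: contraT => nz; set r := _ - _ in nz.
have sym_e : e k \is symmetric := mesym_sym _ _ _.
have sym_r j : (j < N)%N -> sw j r = r.
  move=> hj; rewrite /r /sw msymB msymZ -/(sw j (dY (e k))) dY_mesym_sw //.
  by rewrite -/(sw j (e k)) sw_symmetric.
have ene : msupp (e k) != [::].
  have [h hh] : exists h : {set 'I_N.+1}, #|h| = k.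
    exists [set i : 'I_N.+1 | (i < k)%N]; rewrite -sum1dep_card.
    by rewrite (big_ord_narrow hk) sum1_card card_ord.
  have : mesym1 h \in msupp (e k) by rewrite mcoeff_msupp mcoeff_mesym1 ?oner_eq0.
  by case: (msupp _).
have rne : msupp r != [::] by rewrite msupp_eq0.
have [z0 z0e z0max] := exists_max_seq (fun=> 0%N) (linm id) ene.
have [z zr zmax] := exists_max_seq (fun=> 0%N) (linm id) rne.
have {}z0max m : m \in msupp (e k) -> (linm id m <= linm id z0)%N.
  by move=> /z0max [//|[]].
have {}zmax m : m \in msupp r -> (linm id m <= linm id z)%N.
  by move=> /zmax [//|[]].
have [h0 h0k ez0] := msupp_mesym1 z0e.
have supp_r : supp_in (fun m => mdeg m = k /\ (sqm m <= k)%N) r.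
  have supp_e : supp_in (fun m => exists2 h : {set 'I_N.+1}, #|h| = k & m = mesym1 h) (e k).
    by move=> m; exact: msupp_mesym1.
  rewrite /r; apply: supp_inD; last first.
    apply: supp_inN; apply: supp_inZ => m /supp_e [h hh ->].
    by rewrite mdeg_mesym1 sqm_mesym1 hh.
  apply: (supp_in_linear (@dY_is_linear N R t u) _ supp_e) => m [h hh ->].
  rewrite -[dY _](subrK ((\sum_(i < N.+1) u ^+ rk (mesym1 h) i *
    (mesym1 h i)%:R) *: 'X_[mesym1 h])).
  apply: supp_inD; last first.
    by apply: supp_inZ; apply: supp_inX; rewrite mdeg_mesym1 sqm_mesym1 hh.
  apply: supp_in_impl _ (@dY_tri N R t u ut (mesym1 h)) => m'.
  by rewrite /below_self /below mdeg_mesym1 sqm_mesym1 hh; lia.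
have ez : z = z0.
  have [degz sqz] := supp_r _ zr.
  apply: nondecreasing_bool_eq.
  - exact: max_nondecreasing sym_r zr zmax.
  - apply: max_nondecreasing z0e z0max => j hj; exact: sw_symmetric.
  - by apply: bool_of_sqm; rewrite degz.
  - by rewrite ez0; apply: bool_of_sqm; rewrite sqm_mesym1 mdeg_mesym1.
  - by rewrite degz ez0 mdeg_mesym1.
move: zr; rewrite ez mcoeff_msupp /r mcoeffB mcoeffZ.
rewrite (tri_coef (@dY_is_linear N R t u) (@dY_tri N R t u ut)); last first.
  move=> m me [_]; have := z0max _ me; have [h hh ->] := msupp_mesym1 me.
  by rewrite ez0 !sqm_mesym1 hh h0k; lia.
rewrite ez0 mcoeff_mesym1 // !mulr1 (eq_bigr (fun i =>
  if i \in h0 then u ^+ rk (mesym1 h0) i else 0)); last first.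
  by move=> i _; rewrite mnmE; case: (i \in h0); rewrite ?mulr1 ?mulr0.
by rewrite -big_mkcond upset_sum ?h0k ?subrr ?eqxx //; exact: upset_mesym1.
Qed.

End ElementarySymmetric.

(** * Joint eigenvectors and their products with $e_k$ *)

Section Eigenvectors.

Context (N : nat) (R : idomainType) (t u : R) (ut : u * t = 1).
Context (u_inj : injective (fun k : nat => u ^+ k)).
Context (u_free : forall (k : 'I_N.+1 -> nat) (a b : 'I_N.+1 -> nat),
  injective k ->
  \sum_i u ^+ k i * (a i)%:R = \sum_i u ^+ k i * (b i)%:R -> a =1 b).
Local Notation P := {mpoly R[N.+1]}.
Local Notation Y := (cher t u (@id P)).
Local Notation dY := (@dY N R t u).
Local Notation e := (mesym N.+1 R).
Implicit Types (f g s : P) (m nu : 'X_{1..N.+1}) (h S : {set 'I_N.+1}).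

Definition eigen1 nu f := (forall i : 'I_N.+1, Y i f = u ^+ rk nu i *: f) /\
  dY f = (\sum_(i < N.+1) u ^+ rk nu i * (nu i)%:R) *: f.

(** At a maximal monomial [z] of $f$ the diagonal entries must equal the eigenvalues of [nu]. The
    $Y_i$ yield equal ranks, and then the independence of distinct powers of [u] yields equal
    parts. *)
Lemma eigen1_top nu f : eigen1 nu f -> f != 0 ->
  f@_nu != 0 /\ forall m, m \in msupp f -> (sqm m <= sqm nu)%N.
Proof.
move=> [Yf dYf] nz; have fne : msupp f != [::] by rewrite msupp_eq0.
have [z zf zmax] := exists_max_seq (@sqm N) (linm id) fne.
have zmax' m : m \in msupp f -> ~ below_self m z.
  by move=> /zmax h [_]; lia.
have fz : f@_z != 0 by rewrite -mcoeff_msupp.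
have rkz i : rk z i = rk nu i.
  apply: u_inj; apply: (mulIf fz).
  rewrite /= -[RHS]mcoeffZ -Yf.
  by rewrite (tri_coef (Y_is_linear t u i) (@Y_tri N R t u ut i) zmax').
have ez : z = nu.
  apply/mnmP; apply: (u_free (@rk_inj _ nu)); apply: (mulIf fz).
  rewrite -[RHS]mcoeffZ -dYf.
  rewrite (tri_coef (@dY_is_linear N R t u) (@dY_tri N R t u ut) zmax').
  by congr (_ * _); apply: eq_bigr => i _; rewrite rkz.
by rewrite -ez; split=> // m /zmax; lia.
Qed.

Definition macdonald1 nu f := eigen1 nu f /\ f@_nu = 1.

Lemma macdonald1_uniq nu f g : macdonald1 nu f -> macdonald1 nu g -> f = g.
Proof.
move=> [[Yf dYf] f1] [[Yg dYg] g1]; apply/eqP; rewrite -subr_eq0.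
apply: contraT => nz; have [|] := eigen1_top _ nz (nu := nu).
  split=> [i|]; last by rewrite linearB /= dYf dYg scalerBr.
  have := Y_is_linear t u i (-1) g f; rewrite !scaleN1r ![- g + f]addrC => ->.
  by rewrite Yf Yg addrC scalerBr addrC.
by rewrite mcoeffB f1 g1 subrr eqxx.
Qed.

(** Here [z] is [nu] raised by 1 on $S\setminus h$ and lowered by 1 on $h\setminus S$. The raised
    parts are at least as large as the lowered ones, so the sum of squares grows. *)
Lemma sqm_exchange nu z S h : upset nu S -> #|h| = #|S| -> h != S ->
  (nu + mesym1 S)%MM = (mesym1 h + z)%MM -> (sqm nu < sqm z)%N.
Proof.
move=> upS card_h ne eq_m.
pose th := (\max_(j | j \notin S) nu j)%N.
have th_out j : j \notin S -> (nu j <= th)%N.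
  by move=> jS; rewrite /th (bigD1 j) //= leq_maxl.
have th_in i : i \in S -> (th <= nu i)%N.
  move=> iS; apply/bigmax_leqP => j jS; have := upS i j iS jS; rewrite /beats; lia.
(* A bound for each position, with [th.*2] as a Lagrange multiplier for the constraint $|h|=|S|$:
   its total contribution is the same on both sides. *)
have pt i : (nu i * nu i + th.*2 * mesym1 S i + (mesym1 S i != mesym1 h i) <=
             z i * z i + th.*2 * mesym1 h i)%N.
  have := congr1 (fun m : 'X_{1..N.+1} => m i) eq_m.
  rewrite !mnmDE !mnmE; have := th_out i; have := th_in i.
  case: (i \in S); case: (i \in h) => /=; move=> h1 h2 h3; rewrite -!muln2.
  - by (have -> : nu i = z i by lia); rewrite addn0.
  - by have := h1 isT; nia.
  - by have := h2 isT; nia.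
  - by (have -> : nu i = z i by lia); rewrite addn0.
have := @leq_sum _ (index_enum 'I_N.+1) xpredT _ _ (fun i _ => pt i).
rewrite !big_split /= -/(sqm nu) -/(sqm z) -!big_distrr /= -!mdegE.
rewrite !mdeg_mesym1 card_h.
have : (0 < \sum_(i < N.+1) (mesym1 S i != mesym1 h i))%N; last first.
  by move: (\sum_(i < N.+1) _)%N (th.*2 * _)%N => D E; lia.
rewrite lt0n; apply: contra ne; rewrite sum_nat_eq0 => /forallP h0.
apply/eqP/inj_mesym1/mnmP => i; have := h0 i; rewrite /= eqb0 negbK.
by move=> /eqP ->.
Qed.

(** Ranks do not change when 1 is added on $S$, so the eigenvalue of [dY] grows by $\sum_{i\in
    S}u^{k_i}$, which is exactly the constant of $e_{|S|}$. *)
Lemma macdonald1_mesym nu f S : macdonald1 nu f -> upset nu S ->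
  macdonald1 (nu + mesym1 S)%MM (e #|S| * f).
Proof.
move=> [eig f1] upS; have [Yf dYf] := eig.
have sym_e : e #|S| \is symmetric := mesym_sym _ _ _.
have nz : f != 0.
  by apply/eqP => f0; move/eqP: f1; rewrite f0 mcoeff0 eq_sym oner_eq0.
have [_ sq_max] := eigen1_top eig nz.
split; first split=> [i|].
- by rewrite Y_mul_sym // Yf rk_add // -scalerAr.
- rewrite dY_mul_sym // dYf.
  rewrite (cher_sum_scalar ut); last by move=> k; exact: sw_theta.
  have -> : cher_sum t u (theta (e #|S|)) 1 = (\sum_(j < #|S|) u ^+ j) *: e #|S|.
    have le_S : (#|S| <= N.+1)%N by rewrite -[X in (_ <= X)%N]card_ord max_card.
    have := dY_mul_sym t u 1 sym_e.
    by rewrite mulr1 (dY_mesym ut le_S) dY1 // mulr0 add0r.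
  rewrite -scalerAr -[f * _]scalerAr [f * _]mulrC -scalerDl; congr (_ *: _).
  rewrite -(upset_sum u upS) [X in _ + X]big_mkcond -big_split /=.
  apply: eq_bigr => i _; rewrite rk_add // mnmDE natrD mulrDr mnmE.
  by case: (i \in S); rewrite ?mulr1 ?mulr0.
(* A term of $e_{|S|}$ other than $x^S$ would need in $f$ a monomial whose sum of squares exceeds
   that of [nu]. *)
rewrite mesymE mulr_suml raddf_sum /= (bigD1 S) //= big1 ?addr0.
  by rewrite mulrC addmC mcoeffMX.
move=> h /andP[/eqP card_h ne]; apply: memN_msupp_eq0; apply/negP.
rewrite mulrC (perm_mem (msuppMX f (mesym1 h))) => /mapP[z /sq_max le eq_m].
by have := sqm_exchange upS card_h ne eq_m; rewrite ltnNge le.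
Qed.

Lemma macdonald1_mesymX nu f S d : macdonald1 nu f -> upset nu S ->
  macdonald1 (nu + mesym1 S *+ d)%MM (e #|S| ^+ d * f) /\
  upset (nu + mesym1 S *+ d)%MM S.
Proof.
move=> nf upS; elim: d => [|d [IH1 IH2]].
  by rewrite mulm0n addm0 expr0 mul1r.
rewrite exprS -mulrA mulmS [(mesym1 S + _)%MM]addmC addmA; split; last exact: upset_add.
exact: macdonald1_mesym.
Qed.

End Eigenvectors.

(** * Specialisation at q = 1 *)

Lemma fractionP (R : idomainType) (x : {fraction R}) :
  exists a b : R, b != 0 /\ x = a%:F / b%:F.
Proof.
elim/quotW: x => r; exists (\n_r), (\d_r); split; first exact: denom_ratioP.
have nz : (\d_r)%:F != 0 by rewrite tofrac_eq0 denom_ratioP.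
apply: (mulIf nz); rewrite divfK //; unlock tofrac.
rewrite -[LHS]FracField.pi_mul; apply/eqmodP => /=.
rewrite FracField.equivfE /FracField.mulf /= !numden_Ratio ?oner_eq0 //.
all: rewrite ?mulr1 ?mulf_neq0 ?denom_ratioP ?oner_eq0 //.
by rewrite mulrC.
Qed.

Section BaseChange.

Context (N : nat) (R S : idomainType) (psi : {additive R -> S}).
Local Notation mp := (@map_mpoly N.+1 R S psi).
Implicit Types (f : {mpoly R[N.+1]}) (m : 'X_{1..N.+1}).

(* Multiplication by r corresponds to multiplication by s under psi: this covers
   ring morphisms as well as the q-derivative at q = 1. *)
Definition compat (r : R) (s : S) := forall p, psi (r * p) = s * psi p.

Lemma compatX r s k : compat r s -> compat (r ^+ k) (s ^+ k).
Proof.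
move=> rs; elim: k => [|k IH] p; first by rewrite !expr0 !mul1r.
by rewrite !exprS -!mulrA rs IH.
Qed.

Lemma map_mpoly_scale r s f : compat r s -> mp (r *: f) = s *: mp f.
Proof.
by move=> rs; apply/mpolyP => m; rewrite mcoeffZ !mcoeff_map_mpoly mcoeffZ rs.
Qed.

Lemma map_mpoly_msym (p : 'S_N.+1) f : mp (msym p f) = msym p (mp f).
Proof.
by apply/mpolyP => m; rewrite mcoeff_sym !mcoeff_map_mpoly mcoeff_sym.
Qed.

Lemma map_mpoly_mulX m f : mp ('X_[m] * f) = 'X_[m] * mp f.
Proof.
have mono c k : mp (c *: 'X_[k]) = psi c *: 'X_[k].
  apply/mpolyP => l; rewrite mcoeff_map_mpoly !mcoeffZ !mcoeffX.
  by case: eqP; rewrite ?mulr1 // !mulr0 raddf0.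
elim/mpolyind: f => [|c k f _ _ IH]; first by rewrite mulr0 !raddf0 mulr0.
rewrite mulrDr -scalerAr -mpolyXD !raddfD /= !mono IH mulrDr -scalerAr.
by rewrite mpolyXD.
Qed.

Lemma map_heckeT r s k f : compat r s ->
  mp (heckeT r k f) = heckeT s k (mp f).
Proof.
move=> rs; case: (ltnP k N) => hk; last by rewrite !hTN.
apply/esym/hT_uniq => //.
have := congr1 mp (hTE r f hk).
rewrite -!mul_mpolyC !mulrBl !mulrBr -!mulrA !mul_mpolyC.
rewrite /varX !(raddfB mp) /= !(map_mpoly_scale _ rs) !map_mpoly_mulX.
by rewrite !map_mpoly_msym.
Qed.

Context (t u : R) (t' u' : S) (tt' : compat t t') (uu' : compat u u').

Lemma map_hTs a k f : mp (hTs t a k f) = hTs t' a k (mp f).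
Proof.
by rewrite /hTs; elim: (iota a k) => //= j l IH; rewrite (map_heckeT _ _ tt') IH.
Qed.

Lemma map_hTis a k f : mp (hTis t u a k f) = hTis t' u' a k (mp f).
Proof.
rewrite /hTis; elim: (iota a k) => //= j l IH.
rewrite /heckeTi !scalerBl !scale1r !raddfB /= !(map_mpoly_scale _ uu').
by rewrite (map_heckeT _ _ tt') IH.
Qed.

Lemma map_cher (M : {mpoly R[N.+1]} -> {mpoly R[N.+1]}) i f :
  mp (cher t u M i f) =
  u' ^+ i *: hTis t' u' i (N - i) (mp (M (w1 (hTs t 0 i f)))).
Proof. by rewrite /cher (map_mpoly_scale _ (compatX i uu')) map_hTis. Qed.

Lemma map_w1_hTs i f : mp (w1 (hTs t 0 i f)) = w1 (hTs t' 0 i (mp f)).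
Proof. by rewrite /w1 map_mpoly_msym map_hTs. Qed.

End BaseChange.

Section QScale.

Context (N : nat) (R : idomainType) (q : R).
Implicit Types (f : {mpoly R[N.+1]}) (m : 'X_{1..N.+1}).

(** The substitution $x_n\mapsto q\,x_n$, written on coefficients so that base change and
    differentiation in $q$ can be read off. *)
Definition qscale f : {mpoly R[N.+1]} :=
  \sum_(m <- msupp f) (q ^+ m (pos N N) * f@_m) *: 'X_[m].

Lemma mcoeff_qscale f m : (qscale f)@_m = q ^+ m (pos N N) * f@_m.
Proof.
rewrite /qscale raddf_sum /=; have [mf|mf] := boolP (m \in msupp f).
  rewrite (bigD1_seq m) ?msupp_uniq //= mcoeffZ mcoeffX eqxx mulr1 big1 ?addr0 //.
  by move=> k /negbTE ne; rewrite mcoeffZ mcoeffX ne mulr0.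
rewrite (memN_msupp_eq0 mf) mulr0 big_seq big1 // => k kf.
rewrite mcoeffZ mcoeffX; case: eqP kf => [->|_ _]; last by rewrite mulr0.
by rewrite (negbTE mf).
Qed.

Lemma qscale_is_linear : linear qscale.
Proof.
move=> c f g; apply/mpolyP => m; rewrite mcoeff_qscale !mcoeffD !mcoeffZ.
by rewrite !mcoeff_qscale mulrDr mulrCA.
Qed.

Lemma qscaleX m : qscale 'X_[m] = q ^+ m (pos N N) *: 'X_[m].
Proof.
apply/mpolyP => k; rewrite mcoeff_qscale mcoeffZ mcoeffX.
by case: eqP => [->|]; rewrite ?mulr0.
Qed.

End QScale.

Lemma cher_ext N (R : idomainType) (t u : R) M1 M2 i (f : {mpoly R[N.+1]}) :
  M1 =1 M2 -> cher t u M1 i f = cher t u M2 i f.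
Proof. by move=> eM; rewrite /cher eM. Qed.

(** * The operators of the statement in terms of [cher] *)

Section FromDefinitions.

Context (N : nat).
Implicit Types (f : {mpoly Qqt[N.+1]}).

Lemma tvar_neq0 : tvar != 0.
Proof. by rewrite /tvar tofrac_eq0 polyC_eq0 tofrac_eq0 polyX_eq0. Qed.

Lemma TopE (j : 'I_N) f : Top (n := N.+1) j f = heckeT tvar j f.
Proof. by rewrite /heckeT valK. Qed.

Lemma TinvE (j : 'I_N) f : Tinv (n := N.+1) j f = heckeTi tvar tvar^-1 j f.
Proof.
rewrite /heckeTi -TopE /Top /Tinv scalerBr scalerA mulVf ?tvar_neq0 // scale1r.
by rewrite scalerBl scale1r opprB [RHS]addrC addrA subrK.
Qed.

Lemma omegaE f : omega f = qscale qvar (w1 f).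
Proof.
elim/mpolyind: f => [|c m f _ _ IH].
  by rewrite /omega comp_mpoly0 /w1 msym0 /qscale msupp0 big_nil.
rewrite /omega comp_mpolyD comp_mpolyZ -/(omega f) IH w1_is_linear.
rewrite qscale_is_linear; congr (_ *: _ + _).
rewrite comp_mpolyX -[in RHS](mFK m) w1_mono qscaleX mF_pos //.
rewrite -w1_mono mFK /rotf eqxx.
under eq_bigr do rewrite tnth_mktuple exprZn.
rewrite scaler_prod; congr (_ *: _).
  rewrite big_ord_recl /= big1 ?mulr1 => [|i _]; last by rewrite expr1n.
  by congr (_ ^+ m _); apply: val_inj; rewrite /= posK.
rewrite /w1 [in RHS]mpolyXE_id rmorph_prod; apply: eq_bigr => i _.
by rewrite rmorphXn /= msymXU permE.
Qed.

Lemma foldr_ord (T : Type) (G : 'I_N -> T -> T) (H : nat -> T -> T)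
    (p : pred nat) z : (forall j, G j =1 H j) ->
  foldr G z [seq j : 'I_N <- enum 'I_N | p j] = foldr H z [seq k <- iota 0 N | p k].
Proof.
move=> GH; rewrite -val_enum_ord filter_map; elim: (filter _ _) => //= j s ->.
exact: GH.
Qed.

Lemma YopE (i : 'I_N.+1) f : Yop i f = cher tvar tvar^-1 (qscale qvar) i f.
Proof.
have hi : (i <= N)%N by rewrite -ltnS.
have iotaE : iota 0 N = iota 0 i ++ iota i (N - i) by rewrite -iotaD subnKC.
rewrite /Yop (@foldr_ord _ _ (heckeTi tvar tvar^-1) (leq i) _ TinvE).
rewrite (@foldr_ord _ _ (heckeT tvar) (fun j => (j < i)%N) _ TopE) omegaE.
rewrite /cher exprVn; congr (_ *: _).
have -> : [seq k <- iota 0 N | (i <= k)%N] = iota i (N - i).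
  rewrite iotaE filter_cat (eq_in_filter (a2 := pred0)) => [|k]; last first.
    by rewrite mem_iota => h /=; lia.
  rewrite filter_pred0 (eq_in_filter (a2 := predT)) ?filter_predT // => k.
  by rewrite mem_iota => h /=; lia.
have -> // : [seq k <- iota 0 N | (k < i)%N] = iota 0 i.
rewrite iotaE filter_cat (eq_in_filter (a2 := predT)) => [|k]; last first.
  by rewrite mem_iota => h /=; lia.
rewrite filter_predT (eq_in_filter (a2 := pred0)) ?filter_pred0 ?cats0 // => k.
by rewrite mem_iota => h /=; lia.
Qed.

End FromDefinitions.

Section SumOfY.

Context (N : nat) (R : idomainType) (t u : R) (ut : u * t = 1).
Local Notation P := {mpoly R[N.+1]}.
Local Notation Y := (cher t u (@id P)).

Lemma Y_one (i : 'I_N.+1) : Y i 1 = u ^+ rk (0%MM : 'X_{1..N.+1}) i *: 1.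
Proof.
apply/eqP; rewrite -subr_eq0 -mpolyX0; apply/eqP/mpolyP => m; rewrite mcoeff0.
apply: memN_msupp_eq0; apply/negP => /(@Y_tri N R t u ut i 0%MM).
exact: not_below_self0.
Qed.

(** With multiplier 1 the sum is the multiplication by its value at 1, and 1 is an eigenvector of
    each $Y_i$. The ranks of any composition are a permutation of $0,\dots,N$, so the scalar may be
    written with any [nu]. *)
Lemma Y_sum (nu : 'X_{1..N.+1}) (f : P) :
  \sum_(i < N.+1) Y i f = (\sum_(i < N.+1) u ^+ rk nu i) *: f.
Proof.
have rk_sum m : \sum_(i < N.+1) u ^+ rk m i = \sum_(j < N.+1) u ^+ j.
  have := upset_sum u (upset_setT m); rewrite cardsT card_ord => <-.
  by apply: eq_bigl => i; rewrite inE.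
have sumE g : \sum_(i < N.+1) Y i g = cher_sum t u 1 g.
  by apply: eq_bigr => i _; apply: cher_ext => h; rewrite mul1r.
rewrite sumE (cher_sum_scalar ut) => [|k _]; last by rewrite /sw msym1.
rewrite -sumE (eq_bigr (fun i : 'I_N.+1 => u ^+ rk (0%MM : 'X_{1..N.+1}) i *: 1)).
  by rewrite -scaler_suml !rk_sum -scalerAr mulr1.
by move=> i _; rewrite Y_one.
Qed.

End SumOfY.

Section Specialization.

Context (N : nat) (K : fieldType) (t u : K) (ut : u * t = 1).
Local Notation A := {poly K}.
Implicit Types (F : {mpoly A[N.+1]}) (nu : 'X_{1..N.+1}).

Definition ev1 (p : A) : K := p.[1].
Definition dq1 (p : A) : K := p^`().[1].

Lemma ev1_is_additive : additive ev1.
Proof. by move=> p q; rewrite /ev1 hornerD hornerN. Qed.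

Lemma dq1_is_additive : additive dq1.
Proof. by move=> p q; rewrite /dq1 derivB hornerD hornerN. Qed.

HB.instance Definition _ := GRing.isAdditive.Build A K ev1 ev1_is_additive.
HB.instance Definition _ := GRing.isAdditive.Build A K dq1 dq1_is_additive.

Local Notation ev := (@map_mpoly N.+1 A K ev1).
Local Notation dq := (@map_mpoly N.+1 A K dq1).

Lemma compat_ev1 c : compat ev1 c%:P c.
Proof. by move=> p; rewrite /= /ev1 hornerM hornerC. Qed.

Lemma compat_dq1 c : compat dq1 c%:P c.
Proof. by move=> p; rewrite /= /dq1 derivM derivC mul0r add0r hornerM hornerC. Qed.

Lemma ev_qscale F : ev (qscale 'X F) = ev F.
Proof.
apply/mpolyP => m; rewrite !mcoeff_map_mpoly mcoeff_qscale /= /ev1.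
by rewrite hornerM hornerXn expr1n mul1r.
Qed.

Lemma dq_qscale F : dq (qscale 'X F) = dq F + theta (ev F).
Proof.
apply/mpolyP => m; rewrite mcoeffD mcoeff_theta !mcoeff_map_mpoly mcoeff_qscale.
rewrite /= /dq1 /ev1 derivM derivXn hornerD !hornerM hornerMn !hornerXn !expr1n.
by rewrite mul1r addrC.
Qed.

Lemma eigen1_of_poly nu F :
  (forall i : 'I_N.+1, cher t%:P u%:P (qscale 'X) i F =
     ('X^(nu i) * (u ^+ rk nu i)%:P) *: F) ->
  eigen1 t u nu (ev F).
Proof.
move=> YF; split=> [i|].
  have := congr1 ev (YF i); rewrite (map_cher (compat_ev1 t) (compat_ev1 u)).
  rewrite ev_qscale (map_w1_hTs (compat_ev1 t)) /cher => ->.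
  rewrite (@map_mpoly_scale _ _ _ _ _ (u ^+ rk nu i)) // => p.
  by rewrite /= /ev1 !hornerM hornerXn expr1n hornerC mul1r.
(* The eigenvalue equation differentiated in $q$ at $q=1$, by the product rule on both sides. *)
have dYF (i : 'I_N.+1) : cher t u (@id {mpoly K[N.+1]}) i (dq F) +
    cher t u (@theta N K) i (ev F) =
    u ^+ rk nu i *: dq F + (u ^+ rk nu i * (nu i)%:R) *: ev F.
  have := congr1 dq (YF i); rewrite (map_cher (compat_dq1 t) (compat_dq1 u)).
  rewrite dq_qscale (map_w1_hTs (compat_dq1 t)) (map_w1_hTs (compat_ev1 t)).
  rewrite -[w1 (hTs t 0 i (dq F))]scale1r hTis_is_linear scale1r scalerDr.
  rewrite -/(cher t u id i _) -/(cher t u (@theta N K) i _) => ->.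
  apply/mpolyP => m; rewrite mcoeffD !mcoeffZ !mcoeff_map_mpoly mcoeffZ /=.
  rewrite /dq1 /ev1 -mulrA derivM derivXn hornerD !hornerM hornerMn !hornerXn.
  rewrite !expr1n derivM derivC mul0r add0r hornerM hornerC mul1r addrC.
  by rewrite -/(dq1 _) mulrA [in RHS](mulrC (u ^+ _) (nu i)%:R).
(* Adding this multiple of [dq F] to both sides lets [Y_sum] absorb the derivative of the
   eigenvector. *)
apply: (addrI ((\sum_(i < N.+1) u ^+ rk nu i) *: dq F)).
rewrite -{1}(Y_sum ut nu (dq F)) /dY -big_split /= !scaler_suml -big_split /=.
by apply: eq_bigr => i _; rewrite dYF.
Qed.

End Specialization.

(** * Clearing denominators and powers of $q-1$ *)

Section Denominators.

Context (n : nat) (K : fieldType).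
Local Notation A := {poly K}.
Local Notation frac := (@map_mpoly n A {fraction A} (@tofrac A)).
Implicit Types (E : {mpoly {fraction A}[n]}) (F : {mpoly A[n]}).

Lemma clear_denominators E :
  exists (d : A) F, d != 0 /\ d%:F *: E = frac F.
Proof.
elim/mpolyind: E => [|c m E _ _ [d [F [d0 e]]]].
  by exists 1, 0; rewrite oner_eq0 scaler0 raddf0.
have [a [b [b0 ->]]] := fractionP c.
exists (b * d), ((a * d) *: 'X_[m] + b *: F); split; first by rewrite mulf_neq0.
have bF : b%:F != 0 by rewrite tofrac_eq0.
have ab : (b * d)%:F * (a%:F / b%:F) = (a * d)%:F.
  by apply: (mulIf bF); rewrite -mulrA divfK // -!tofracM mulrC mulrCA mulrC.
have mapZ r G : frac (r *: G) = r%:F *: frac G.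
  by apply: map_mpolyZ.
have mapD G H : frac (G + H) = frac G + frac H by rewrite raddfD.
rewrite mapD !mapZ map_mpolyX -e scalerDr !(scalerA, ab).
by rewrite (tofracM b d).
Qed.

(** A polynomial multiple that vanishes at $q=1$ is divisible by $q-1$. As $E$ has coefficient 1 at
    [eta], the multiplier is itself the coefficient at [eta]; its degree drops with each division,
    so the divisions end. *)
Lemma primitive_multiple E (eta : 'X_{1..n}) : E@_eta = 1 ->
  exists F, (F@_eta)%:F *: E = frac F /\ map_mpoly (@ev1 K) F != 0.
Proof.
move=> E1; have [d [F [d0 e]]] := clear_denominators E.
have coefE d' F' : d'%:F *: E = frac F' -> d' = F'@_eta.
  move/(congr1 (mcoeff eta)); rewrite mcoeffZ E1 mulr1 mcoeff_map_mpoly.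
  by move/eqP; rewrite tofrac_eq => /eqP.
have [s] := ubnP (size d); elim: s d F d0 e => // s IH d F d0 e lt_s.
have [ev0|evN0] := eqVneq (map_mpoly (@ev1 K) F) 0; last first.
  by exists F; rewrite -(coefE _ _ e).
pose c : A := 'X - 1%:P.
have c0 : c != 0 by rewrite polyXsubC_eq0.
pose G := \sum_(m <- msupp F) (F@_m %/ c) *: 'X_[m].
have FG : F = c *: G.
  rewrite /G scaler_sumr [LHS]mpolyE; apply: eq_bigr => m _.
  rewrite scalerA mulrC divpK // dvdp_XsubCl.
  by have := congr1 (mcoeff m) ev0; rewrite mcoeff_map_mpoly mcoeff0 => /eqP.
have dG : d = c * G@_eta by rewrite (coefE _ _ e) FG mcoeffZ.
have G0 : G@_eta != 0 by apply: contraNneq d0; rewrite dG => ->; rewrite mulr0.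
apply: (IH _ G G0).
  have cF0 : c%:F != 0 by rewrite tofrac_eq0.
  apply: (scalerI cF0); rewrite scalerA -tofracM -dG e FG.
  exact: map_mpolyZ.
by move: lt_s; rewrite dG size_mul // size_XsubC ltnS.
Qed.

End Denominators.

Lemma map_tofrac_inj n (A : idomainType) :
  injective (@map_mpoly n A {fraction A} (@tofrac A)).
Proof.
move=> f g e; apply/mpolyP => m; apply/eqP; rewrite -tofrac_eq; apply/eqP.
have coefE := mcoeff_map_mpoly (@tofrac A) m.
by rewrite -[LHS]coefE -[RHS]coefE e.
Qed.

Lemma cher_clear N (A : idomainType) (t u q d y : A)
    (E : {mpoly {fraction A}[N.+1]}) (F : {mpoly A[N.+1]}) i :
  d%:F *: E = map_mpoly (@tofrac A) F ->
  cher t%:F u%:F (qscale q%:F) i E = y%:F *: E ->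
  cher t u (qscale q) i F = y *: F.
Proof.
move=> eE YE; apply: map_tofrac_inj.
have compF (r : A) : compat (@tofrac A) r r%:F by move=> p; rewrite /= tofracM.
have qs G : map_mpoly (@tofrac A) (qscale q G) =
    qscale q%:F (map_mpoly (@tofrac A) G) :> {mpoly {fraction A}[N.+1]}.
  apply/mpolyP => m; rewrite mcoeff_map_mpoly !mcoeff_qscale mcoeff_map_mpoly.
  by rewrite /= tofracM tofracXn.
rewrite (map_cher (compF t) (compF u)) qs (map_w1_hTs (compF t)).
rewrite -/(cher t%:F u%:F (qscale q%:F) i _) -eE.
rewrite (linear_funZ (cher_is_linear _ _ _ (qscale_is_linear _))) YE.
rewrite (map_mpoly_scale _ (compF y)) -eE !scalerA.
by rewrite mulrC.
Qed.

Section RegularAtOne.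

Context (N : nat) (K : fieldType) (t u : K) (ut : u * t = 1).
Context (u_inj : injective (fun k : nat => u ^+ k)).
Context (u_free : forall (k : 'I_N.+1 -> nat) (a b : 'I_N.+1 -> nat),
  injective k ->
  \sum_i u ^+ k i * (a i)%:R = \sum_i u ^+ k i * (b i)%:R -> a =1 b).

(* A multiple F of E with polynomial coefficients that does not vanish at q = 1
   specialises to a joint eigenvector, whose coefficient at eta is nonzero by
   triangularity; so dividing by this coefficient creates no pole at q = 1. *)
Lemma regular_at_one (eta : 'X_{1..N.+1}) (E : {mpoly {fraction {poly K}}[N.+1]}) :
  E@_eta = 1 ->
  (forall i : 'I_N.+1, cher (t%:P)%:F (u%:P)%:F (qscale ('X)%:F) i E =
     ('X^(eta i) * (u ^+ rk eta i)%:P)%:F *: E) ->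
  exists2 E1, macdonald1 t u eta E1 &
    forall m, exists p d : {poly K},
      [/\ d.[1] != 0, E@_m = p%:F / d%:F & E1@_m = p.[1] / d.[1]].
Proof.
move=> Eeta YE; have [F [eE evF]] := primitive_multiple Eeta.
have evE := eigen1_of_poly ut (fun i => cher_clear eE (YE i)).
have [d1 _] := eigen1_top ut u_inj u_free evE evF.
have evC m : (map_mpoly (@ev1 K) F)@_m = (F@_m).[1] by rewrite mcoeff_map_mpoly.
rewrite evC in d1.
exists ((F@_eta).[1]^-1 *: map_mpoly (@ev1 K) F).
  case: evE => Yev dYev; split; last by rewrite mcoeffZ evC mulVf.
  split=> [i|].
    by rewrite (linear_funZ (Y_is_linear t u i)) Yev !scalerA mulrC.
  by rewrite (linear_funZ (@dY_is_linear N K t u)) dYev !scalerA mulrC.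
move=> m; exists F@_m, F@_eta; split=> //.
  have := congr1 (mcoeff m) eE; rewrite mcoeffZ mcoeff_map_mpoly /= => <-.
  rewrite mulrAC mulfV ?mul1r // tofrac_eq0.
  by apply: contraNneq d1 => ->; rewrite horner0.
by rewrite mcoeffZ evC mulrC.
Qed.

End RegularAtOne.

Definition tq1 : Qt := ('X : {poly rat})%:F.
Definition uq1 : Qt := tq1^-1.

Lemma uq1_tq1 : uq1 * tq1 = 1.
Proof. by rewrite mulVf // tofrac_eq0 polyX_eq0. Qed.

Lemma tq1_exp k : tq1 ^+ k = ('X^k : {poly rat})%:F.
Proof. by rewrite tofracXn. Qed.

(** Multiplication by a large power of $t$ gives polynomials in $t$ over the rationals, whose
    coefficients at distinct exponents are compared. *)
Lemma uq1_free n (k a b : 'I_n -> nat) : injective k ->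
  \sum_i uq1 ^+ k i * (a i)%:R = \sum_i uq1 ^+ k i * (b i)%:R -> a =1 b.
Proof.
move=> inj_k eq_ab.
pose M := (\max_i k i)%N.
have kM i : (k i <= M)%N by rewrite /M (bigD1 i) //= leq_maxl.
have toP (c : 'I_n -> nat) : tq1 ^+ M * \sum_i uq1 ^+ k i * (c i)%:R =
    (\sum_i (c i)%:R *: 'X^(M - k i) : {poly rat})%:F.
  rewrite mulr_sumr rmorph_sum /=; apply: eq_bigr => i _.
  have -> : tq1 ^+ M = tq1 ^+ (M - k i) * tq1 ^+ k i by rewrite -exprD subnK.
  rewrite mulrA -[_ * uq1 ^+ _]mulrA -exprMn [tq1 * _]mulrC uq1_tq1 expr1n mulr1.
  by rewrite tq1_exp scaler_nat tofracMn mulr_natr.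
have : (\sum_i (a i)%:R *: 'X^(M - k i) : {poly rat}) =
       \sum_i (b i)%:R *: 'X^(M - k i).
  by apply/eqP; rewrite -tofrac_eq -!toP eq_ab.
move=> eq_p i; have coefP (c : 'I_n -> nat) :
    (\sum_j (c j)%:R *: 'X^(M - k j) : {poly rat})`_(M - k i) = (c i)%:R.
  rewrite coef_sum (bigD1 i) //= coefZ coefXn eqxx mulr1 big1 ?addr0 // => j ne.
  rewrite coefZ coefXn; case: eqP => // e; last by rewrite mulr0.
  case/eqP: ne; apply: inj_k; have := kM i; have := kM j; lia.
have := congr1 (fun p : {poly rat} => p`_(M - k i)) eq_p; rewrite !coefP.
by move/eqP; rewrite Num.Theory.eqr_nat => /eqP.
Qed.

Lemma uq1_inj : injective (fun k : nat => uq1 ^+ k).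
Proof.
move=> k l /= e.
have cancel j : uq1 ^+ j * tq1 ^+ j = 1 by rewrite -exprMn uq1_tq1 expr1n.
have : tq1 ^+ l = tq1 ^+ k.
  by rewrite -[LHS]mul1r -(cancel k) e mulrAC cancel mul1r.
rewrite !tq1_exp => /eqP; rewrite tofrac_eq => /eqP.
by move/(congr1 (fun p : {poly rat} => size p)); rewrite !size_polyXn => -[].
Qed.

Lemma tq1E : (tq1%:P : {poly Qt})%:F = tvar. Proof. exact: erefl. Qed.

Lemma uq1E : (uq1%:P : {poly Qt})%:F = tvar^-1.
Proof.
apply: (mulIf tvar_neq0); rewrite mulVf ?tvar_neq0 // -tq1E -tofracM -polyCM.
by rewrite uq1_tq1 tofrac1.
Qed.

Lemma yval_q1 n (eta : 'X_{1..n}) i :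
  yval eta i = ('X^(eta i) * (uq1 ^+ rk eta i)%:P)%:F.
Proof.
by rewrite tofracM tofracXn polyC_exp tofracXn uq1E exprVn.
Qed.

Lemma macdonald_at1 N (eta : 'X_{1..N.+1}) (E : {mpoly Qqt[N.+1]}) :
  is_nonsym_macdonald eta E ->
  exists2 E1, specializes_q1 E E1 & macdonald1 tq1 uq1 eta E1.
Proof.
move=> [_ Eeta YE].
have [E1 E1P spec] : exists2 E1, macdonald1 tq1 uq1 eta E1 & specializes_q1 E E1.
  apply: (regular_at_one uq1_tq1 uq1_inj (@uq1_free N.+1) Eeta) => i.
  have := YE i; rewrite YopE (yval_q1 eta i) -uq1E /qvar /tvar; exact.
by exists E1.
Qed.

(** * Changing the parts of a composition *)

Lemma frac_quotient_exp (A : idomainType) (x y a b : A) d : y != 0 -> b != 0 ->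
  b ^+ d * x = a ^+ d * y -> x%:F / y%:F = (a%:F / b%:F) ^+ d.
Proof.
move=> y0 b0 e; rewrite expr_div_n -!tofracXn.
have yF : y%:F != 0 by rewrite tofrac_eq0.
have bF : (b ^+ d)%:F != 0 by rewrite tofrac_eq0 expf_neq0.
by apply/eqP; rewrite eqr_div // -!tofracM -e mulrC.
Qed.

(** At a changed position exactly one side is shifted, which compensates the change; elsewhere both
    sides are shifted or neither is. *)
Lemma change_part_shift n (eta etahat : 'X_{1..n}) (a b : nat) : (a < b)%N ->
  (forall i : 'I_n, ~~ (a < eta i < b)%N) ->
  etahat = change_part a b eta \/ etahat = change_part b a eta ->
  (eta + mesym1 [set i | b <= etahat i]%N *+ (b - a) =
   etahat + mesym1 [set i | b <= eta i]%N *+ (b - a))%MM.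
Proof.
move=> lt_ab gap chg; apply/mnmP => i; rewrite !mnmDE !mulmnE !mnmE !inE.
have := gap i; case: chg => ->; rewrite mnmE.
- by case: eqP => [->|]; rewrite ?leqnn; case: leqP => /=; lia.
- by case: eqP => [->|]; rewrite ?leqnn; case: leqP => /=; lia.
Qed.

(** As no part lies between $a$ and $b$, the positions with $\hat\eta_i\ge b$ are those with
    $\eta_i\ge a$ or those with $\eta_i>b$. In $\hat\eta$ the former parts $a$ and $b$ are equal and
    only their positions separate them: the former $b$ lie to the right and so rank higher. *)
Lemma upset_change_part n (eta etahat : 'X_{1..n}) (a b : nat) : (a < b)%N ->
  (forall i j : 'I_n, eta i = a -> eta j = b -> (i < j)%N) ->
  (forall i : 'I_n, ~~ (a < eta i < b)%N) ->
  etahat = change_part a b eta \/ etahat = change_part b a eta ->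
  upset eta [set i | b <= etahat i]%N /\ upset etahat [set i | b <= eta i]%N.
Proof.
move=> lt_ab ord gap chg; split=> i j; rewrite !inE /beats; have := ord i j;
  have := ord j i; have := gap i; have := gap j; case: chg => ->; rewrite !mnmE.
all: by do 2 case: eqP => ?; lia.
Qed.

Lemma macdonald_ratio_succ N (eta etahat : 'X_{1..N.+1}) (a b : nat)
    (E Ehat : {mpoly Qqt[N.+1]}) :
  (a < b)%N ->
  (forall i j : 'I_N.+1, eta i = a -> eta j = b -> (i < j)%N) ->
  (forall i : 'I_N.+1, ~~ (a < eta i < b)%N) ->
  etahat = change_part a b eta \/ etahat = change_part b a eta ->
  is_nonsym_macdonald eta E ->
  is_nonsym_macdonald etahat Ehat ->
  exists E1 Ehat1 : {mpoly Qt[N.+1]},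
    [/\ specializes_q1 E E1,
        specializes_q1 Ehat Ehat1
      & E1%:F / Ehat1%:F =
        ((mesym N.+1 Qt (num_ge b eta))%:F / (mesym N.+1 Qt (num_ge b etahat))%:F)
          ^+ (b - a)].
Proof.
move=> lt_ab ord gap chg macE macEhat.
have [E1 specE E1P] := macdonald_at1 macE.
have [Ehat1 specEhat Ehat1P] := macdonald_at1 macEhat.
exists E1, Ehat1; split=> //.
have [up uphat] := upset_change_part lt_ab ord gap chg.
have [h1 _] := macdonald1_mesymX uq1_tq1 uq1_inj (@uq1_free N.+1) (b - a) E1P up.
have [h2 _] :=
  macdonald1_mesymX uq1_tq1 uq1_inj (@uq1_free N.+1) (b - a) Ehat1P uphat.
rewrite (change_part_shift lt_ab gap chg) in h1.
apply: frac_quotient_exp.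
- case: Ehat1P => _ c1; apply/eqP => e0; move/eqP: c1.
  by rewrite e0 mcoeff0 eq_sym oner_eq0.
- apply/eqP => e0; have := @mcoeff_mesym1 N Qt (num_ge b etahat) _ erefl.
  by move/eqP; rewrite e0 mcoeff0 eq_sym oner_eq0.
exact: (macdonald1_uniq uq1_tq1 uq1_inj (@uq1_free N.+1) h1 h2).
Qed.

Theorem theorem4p1 (n : nat) (eta etahat : 'X_{1..n}) (a b : nat)
    (E Ehat : {mpoly Qqt[n]}) :
  (a < b)%N ->
  (forall i j : 'I_n, eta i = a -> eta j = b -> (i < j)%N) ->
  (forall i : 'I_n, ~~ (a < eta i < b)%N) ->
  etahat = change_part a b eta \/ etahat = change_part b a eta ->
  is_nonsym_macdonald eta E ->
  is_nonsym_macdonald etahat Ehat ->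
  exists E1 Ehat1 : {mpoly Qt[n]},
    [/\ specializes_q1 E E1,
        specializes_q1 Ehat Ehat1
      & E1%:F / Ehat1%:F =
        ((mesym n Qt (num_ge b eta))%:F / (mesym n Qt (num_ge b etahat))%:F)
          ^+ (b - a)].
Proof.
case: n eta etahat E Ehat => [|N] eta etahat E Ehat; last exact: macdonald_ratio_succ.
(* Without variables a polynomial is its single coefficient, here 1, and both ratios are 1. *)
move=> _ _ _ _ [_ E1 _] [_ Ehat1 _].
have one (nu : 'X_{1..0}) (G : {mpoly Qqt[0]}) : G@_nu = 1 -> specializes_q1 G 1.
  move=> G1 m; exists 1, 1; rewrite hornerC oner_eq0 tofrac1 !divr1; split=> //.
    by rewrite -G1; congr mcoeff; apply/mnmP => -[].
  rewrite mcoeff1 (_ : m == 0%MM) //; apply/eqP/mnmP => -[] //.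
exists 1, 1; split; [exact: one E1|exact: one Ehat1|].
have num0 (nu : 'X_{1..0}) : num_ge b nu = 0%N.
  by apply/eqP; rewrite cards_eq0; apply/eqP/setP => -[].
by rewrite !num0 mesym0E tofrac1 !divr1 expr1n.
Qed.
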